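(* Let $n\ge1$, $\vec a=(a_0,\dots,a_n)\in\mathbb{Z}^{n+1}$, and let $G=G_{\vec a}$ be the finite directed graph defined in the context. The tropical entropy $H_{\vec a}$ equals the maximum of $d(T)/l(T)$ over all simple cycles $T$ in $G$, where $d(T)$ is the number of augmenting edges of $T$ and $l(T)$ is the length of $T$. In particular, $H_{\vec a}$ is a rational number.
   Context: Let $n\ge 1$, $\vec a=(a_0,\dots,a_n)\in\mathbb{Z}^{n+1}$, $M:=\max_i a_i-\min_i a_i$. A sequence $(z_1,\dots,z_k)\in\mathbb{R}^k$ (or an infinite real sequence) satisfies $\vec a$ if for every $j\ge1$ for which $z_{j+n}$ is a term of the sequence, the minimum $\min_{0\le i\le n}\{z_{j+i}+a_i\}$ is attained for at least two different $i$; such sequences are called tropical recurrent sequences satisfying $\vec a$. $D(k)\subset\mathbb{R}^k$ is the set of all such sequences of length $k$ (so $D(k)=\mathbb{R}^k$ for $k\le n$); it is a finite union of polyhedra, and $d_{\vec a}(k):=\dim D(k)$ (maximal dimension of a polyhedron in it) is the tropical Hilbert function. The tropical entropy is $H_{\vec a}:=\lim_{k\to\infty}d_{\vec a}(k)/k$ (the limit exists since $d_{\vec a}(k+t)\le d_{\vec a}(k)+d_{\vec a}(t)$). Polyhedra are allowed to be defined by linear equations and by strict and non-strict linear inequalities. Vertices of $G$. A vertex $v$ is given by: a nonempty set $B=B_v\subset\{1,\dots,n\}$; an element $s=s_v\in B$; and, for each pair $r<l$ in $B$, an integer $m(r,l)=m_v(r,l)$ and an indicator $e(r,l)=e_v(r,l)\in\{0,1\}$,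 such that $m(s,q)\ge -nM$ for $q\in B$, $q>s$; $m(p,s)\le (n+s-p)M$ for $p\in B$, $p<s$; $|m(r,l)|\le 2nM$ for all $r<l$ in $B$; and such that the polyhedron $P_v\subset\mathbb{R}^n$ is nonempty, where $P_v$ is the set of $(y_1,\dots,y_n)$ with - $y_s\le y_j$ for $1\le j\le n$; - $y_r=y_l+m(r,l)$ for $r<l$ in $B$ with $e(r,l)=0$; - $y_r-1<y_l+m(r,l)<y_r$ for $r<l$ in $B$ with $e(r,l)=1$; - $y_j-y_s>jM$ for $1\le j\le n$, $j\notin B$. Here $s$ is the smallest element of $B$ at which the minimum of the coordinates is attained on $P_v$. Coordinates with index in $B$ are called bounded, the others unbounded. All such data with $P_v\neq\emptyset$ give the vertices of $G$. The set $S_v$. For $(y_1,\dots,y_n)\in P_v$, the set $S=S_v$ of $r\in\{1,\dots,n\}$ at which $\min_{1\le r\le n}\{y_r+a_{r-1}\}$ is attained is contained in $B_v$ and does not depend on the chosen point of $P_v$. Edges of $G$. Let $v$ be a vertex, $B=B_v$, $B^-:=\{r-1: r\in B,\ r\ge 2\}$. For every edge $(v,w)$ one requires $m_w(r-1,l-1)=m_v(r,l)$ and $e_w(r-1,l-1)=e_v(r,l)$ for all $r<l$ in $B$ with $r\ge2$. The edges from $v$ are exactly the following. (E1) If $S_v=\{t\}$ is a singleton: there is exactly one edge from $v$, to the vertex $w$ with $B_w=B^-\cup\{n\}$, where, putting $x_i=y_{i+1}$ ($1\le i<n$) and $x_n=y_t+a_{t-1}-a_n$ for a point $y\in P_v$,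 one sets for $r\in B^-$: $m_w(r,n)=\lfloor x_r-x_n\rfloor$, and $e_w(r,n)=0$ if $x_r-x_n\in\mathbb{Z}$, $e_w(r,n)=1$ otherwise (this does not depend on $y$); $s_w$ is the smallest element of $B_w$ at which $\min_{i\in B_w}x_i$ is attained. If $|S_v|\ge2$, let $t$ be the smallest element of $S_v$ with $t>1$, and let $s'$ be the smallest element of $B^-$ at which $\min_{i\in B^-}y_{i+1}$ is attained (independent of $y\in P_v$). Then the edges from $v$ are: (E2) one edge to the vertex $w$ with $B_w=B^-$, $s_w=s'$ (so $n$ is unbounded, and $x_n-x_{s'}>nM$ on $P_w$); (E3) an edge to every vertex $w$ with $B_w=B^-\cup\{n\}$ (and $m_w,e_w$ on $B^-$ as prescribed above) such that $m_w(t-1,n)\le a_n-a_{t-1}-e_w(t-1,n)$ and $m_w(s',n)\ge -nM$. An edge $(v,w)$ is called rigid if for a point $(y_1,\dots,y_n)\in P_v$ there is a unique $x\in\mathbb{R}$ such that $(y_1,\dots,y_n,x)$ satisfies $\vec a$ and $(y_2,\dots,y_n,x)\in P_w$; it is called augmenting if these $x$ run over an open interval (every edge is rigid or augmenting, independently of the point of $P_v$). The length of a path or cycle is its number of edges; loops count as simple cycles of length 1. *)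

(* Defs.v *)
From HB Require Import structures.
From mathcomp Require Import all_boot all_order all_algebra.
From mathcomp Require Import all_classical all_reals all_analysis.
Set Implicit Arguments.
Unset Strict Implicit.
Unset Printing Implicit Defensive.
Import Order.TTheory GRing.Theory Num.Theory.
Import numFieldNormedType.Exports.
Local Open Scope classical_set_scope.
Local Open Scope ring_scope.

(* Indices are 0-based: the coordinate y_r (1 <= r <= n) of a point of R^n is
   [y 0 i] with [i : 'I_n] and [r = i + 1].  The coefficients a_0, ..., a_n are
   indexed by ['I_n.+1] exactly as in the text, so that a_(r-1), which
   accompanies y_r, is [a (widen_ord (leqnSn n) i)]. *)

Section Hilbert.
Variable R : realType.

Definition min_attained_twice (p : nat) (c : 'I_p -> R) : Prop :=
  exists i1 i2 : 'I_p,
    i1 != i2 /\ forall i : 'I_p, c i1 <= c i /\ c i2 <= c i.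

(* [w] enumerates the positions j, j+1, ..., j+n of a window of [z]; such a [w]
   exists iff the window fits into the sequence. *)
Definition satisfies (n : nat) (a : 'I_n.+1 -> int) (k : nat)
    (z : 'rV[R]_k) : Prop :=
  forall (j : nat) (w : 'I_n.+1 -> 'I_k),
    (forall i : 'I_n.+1, w i = (j + i)%N :> nat) ->
    min_attained_twice (fun i : 'I_n.+1 => z 0 (w i) + (a i)%:~R).

Definition trop_rec_seqs (n : nat) (a : 'I_n.+1 -> int) (k : nat) :
  set 'rV[R]_k := [set z | satisfies a z].

Definition polyhedron (k : nat) (P : set 'rV[R]_k) : Prop :=
  exists (p q r : nat)
    (A : 'M[R]_(p, k)) (b : 'cV[R]_p)
    (C : 'M[R]_(q, k)) (d : 'cV[R]_q)
    (E : 'M[R]_(r, k)) (f : 'cV[R]_r),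
  P = [set z | [/\ A *m z^T = b,
                   forall i, (C *m z^T) i 0 <= d i 0
                 & forall i, (E *m z^T) i 0 < f i 0]].

(* Dimension of the affine hull of P: the largest d such that P contains d + 1
   affinely independent points x, x + X_1, ..., x + X_d. *)
Definition affine_dim (k : nat) (P : set 'rV[R]_k) : nat :=
  \max_(d < k.+1 | `[< exists (x : 'rV[R]_k) (X : 'M[R]_(d, k)),
                        [/\ P x, row_free X
                          & forall i : 'I_d, P (x + row i X)] >]) d.

(* For A a finite union of polyhedra: the maximal dimension of a polyhedron
   contained in A. *)
Definition polyhedral_dim (k : nat) (A : set 'rV[R]_k) : nat :=
  \max_(d < k.+1 | `[< exists P : set 'rV[R]_k,
                        [/\ polyhedron P, P !=set0, P `<=` A
                          & affine_dim P = d] >]) d.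

Definition trop_hilbert (n : nat) (a : 'I_n.+1 -> int) (k : nat) : nat :=
  polyhedral_dim (@trop_rec_seqs n a k).

Definition trop_hilbert_ratio (n : nat) (a : 'I_n.+1 -> int) : R^nat :=
  fun k => (trop_hilbert a k)%:R / k%:R.

Definition trop_entropy (n : nat) (a : 'I_n.+1 -> int) : R :=
  limn (trop_hilbert_ratio a).

End Hilbert.

Definition spread (n : nat) (a : 'I_n.+1 -> int) : int :=
  \big[Num.max/a ord0]_(i < n.+1) a i - \big[Num.min/a ord0]_(i < n.+1) a i.

(* Only the entries of [vm] and [ve] at pairs r < l in [vB] are meaningful;
   [is_vertex] below forces the other entries to be 0 and false, so that equal
   vertices are equal as elements of this type. *)
Record vertex (n : nat) := Vertex {
  vB : {set 'I_n};
  vs : 'I_n;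
  vm : 'M[int]_n;
  ve : 'M[bool]_n }.

Definition vertex_code (n : nat) (v : vertex n) := (vB v, vs v, vm v, ve v).

Definition vertex_decode (n : nat)
    (c : {set 'I_n} * 'I_n * 'M[int]_n * 'M[bool]_n) : vertex n :=
  let: (B, s, m, e) := c in Vertex B s m e.

Lemma vertex_codeK (n : nat) :
  cancel (@vertex_code n) (@vertex_decode n).
Proof. by case. Qed.

HB.instance Definition _ (n : nat) :=
  Equality.copy (vertex n) (can_type (@vertex_codeK n)).

(* B^- = {r - 1 : r \in B, r >= 2}. *)
Definition Bminus (n : nat) (B : {set 'I_n}) : {set 'I_n} :=
  [set j : 'I_n | [exists i in B, i == j.+1 :> nat]].

(* The singleton consisting of the last index (n, when counted from 1). *)
Definition last_index (n : nat) : {set 'I_n} :=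
  [set j : 'I_n | j.+1 == n].

Section Graph.
Variables (R : realType) (n : nat) (a : 'I_n.+1 -> int).

Local Notation M := (spread a).

(* The coefficient accompanying the coordinate r: a_(r-1) when r is counted
   from 1. *)
Definition coef (r : 'I_n) : int := a (widen_ord (leqnSn n) r).

Definition polyh (v : vertex n) : set 'rV[R]_n :=
  [set y | [/\ forall j, y 0 (vs v) <= y 0 j,
    forall r l, r \in vB v -> l \in vB v -> (r < l)%N -> ~~ ve v r l ->
      y 0 r = y 0 l + (vm v r l)%:~R,
    forall r l, r \in vB v -> l \in vB v -> (r < l)%N -> ve v r l ->
      y 0 r - 1 < y 0 l + (vm v r l)%:~R < y 0 r
  & forall j, j \notin vB v ->
      (j.+1%:Z * M)%:~R < y 0 j - y 0 (vs v)]].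

Definition first_min (B : {set 'I_n}) (y : 'rV[R]_n) (s : 'I_n) : Prop :=
  [/\ s \in B,
      forall i, i \in B -> y 0 s <= y 0 i
    & forall i, i \in B -> (i < s)%N -> y 0 s < y 0 i].

Definition is_vertex (v : vertex n) : Prop :=
  [/\ vs v \in vB v,
      [/\ forall q, q \in vB v -> (vs v < q)%N ->
            - (n%:Z * M) <= vm v (vs v) q,
          forall p, p \in vB v -> (p < vs v)%N ->
            vm v p (vs v) <= (n + vs v - p)%N%:Z * M
        & forall r l, r \in vB v -> l \in vB v -> (r < l)%N ->
            `|vm v r l| <= 2 * n%:Z * M],
      forall r l, ~~ [&& r \in vB v, l \in vB v & (r < l)%N] ->
        vm v r l = 0 /\ ve v r l = false,
      polyh v !=set0
    & forall y, polyh v y -> first_min (vB v) y (vs v)].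

(* (y_1, ..., y_n, x) *)
Definition extend (y : 'rV[R]_n) (x : R) : 'rV[R]_n.+1 :=
  \row_(i < n.+1) oapp (y 0) x (unlift ord_max i).

(* (y_2, ..., y_n, x) *)
Definition push (y : 'rV[R]_n) (x : R) : 'rV[R]_n :=
  \row_(i < n) extend y x 0 (lift ord0 i).

(* On [polyh v] this set is independent of the point [y]: it is S_v. *)
Definition argmin_set (y : 'rV[R]_n) : {set 'I_n} :=
  [set r | [forall l, y 0 r + (coef r)%:~R <= y 0 l + (coef l)%:~R]].

Definition inherits (v w : vertex n) : Prop :=
  forall r l r' l' : 'I_n, r \in vB v -> l \in vB v -> (r < l)%N ->
    r = r'.+1 :> nat -> l = l'.+1 :> nat ->
    vm w r' l' = vm v r l /\ ve w r' l' = ve v r l.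

Definition edge_E1 (v w : vertex n) (y : 'rV[R]_n) : Prop :=
  exists t : 'I_n,
    let x := push y (y 0 t + (coef t)%:~R - (a ord_max)%:~R) in
    [/\ argmin_set y = [set t]%SET,
        vB w = Bminus (vB v) :|: last_index n,
        forall r l, r \in Bminus (vB v) -> l \in last_index n ->
          vm w r l = Num.floor (x 0 r - x 0 l) /\
          ve w r l = (x 0 r - x 0 l \isn't a Num.int)
      & first_min (vB w) x (vs w)].

(* The last coordinate 0 given to [push] is irrelevant: the last index does not
   belong to B^-. *)
Definition is_sprime (v : vertex n) (y : 'rV[R]_n) (s' : 'I_n) : Prop :=
  first_min (Bminus (vB v)) (push y 0) s'.

Definition edge_E2 (v w : vertex n) (y : 'rV[R]_n) : Prop :=
  [/\ (2 <= #|argmin_set y|)%N,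
      vB w = Bminus (vB v)
    & is_sprime v y (vs w)].

(* [t'] stands for t - 1. *)
Definition edge_E3 (v w : vertex n) (y : 'rV[R]_n) : Prop :=
  [/\ (2 <= #|argmin_set y|)%N,
      vB w = Bminus (vB v) :|: last_index n
    & exists t t' s' : 'I_n,
      [/\ [/\ t \in argmin_set y, (0 < t)%N
            & forall r, r \in argmin_set y -> (0 < r)%N -> (t <= r)%N],
          t = t'.+1 :> nat,
          is_sprime v y s'
        & forall l, l \in last_index n ->
            vm w t' l <= a ord_max - coef t - (ve w t' l)%:Z /\
            - (n%:Z * M) <= vm w s' l]].

(* The conditions do not depend on the point [y] of [polyh v]. *)
Definition edge (v w : vertex n) : Prop :=
  [/\ is_vertex v, is_vertex w, inherits v w
    & exists2 y, polyh v y & [\/ edge_E1 v w y, edge_E2 v w y | edge_E3 v w y]].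

Definition continuations (v w : vertex n) (y : 'rV[R]_n) : set R :=
  [set x | satisfies a (extend y x) /\ polyh w (push y x)].

(* Again independent of the point [y] of [polyh v]. *)
Definition augmenting (v w : vertex n) : Prop :=
  exists2 y, polyh v y &
    let X := continuations v w y in
    [/\ open X, is_interval X & X !=set0].

Definition simple_cycle (T : seq (vertex n)) : Prop :=
  T != [::] /\ ucycle (fun v w => `[< edge v w >]) T.

Definition num_augmenting (T : seq (vertex n)) : nat :=
  count (fun v => `[< augmenting v (next T v) >]) T.

Definition cycle_ratio (T : seq (vertex n)) : R :=
  (num_augmenting T)%:R / (size T)%:R.

End Graph.

(* Main.v *)
(* The graph is a symbolic description of all tropical recurrent sequences.  Fix
   the integer data of a vertex v: the position of every difference y_r - y_l of
   bounded coordinates with respect to the integers is then constant on P_v, and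
   hence so are S_v and everything that decides which x continue y.  So for an
   edge (v, w) the admissible x form, uniformly in y in P_v, either one point
   y_j + c (with j and c depending on the edge only) or a nonempty open interval.
   Conversely the windows of length n of a recurrent sequence follow a path of G.

   Upper bound for the Hilbert function: a polyhedron inside D(k) contains a
   polynomial curve through its affine directions; infinitely many points of the
   curve follow the same path (there are finitely many), and along a rigid edge
   the new coordinate is a copy of an earlier one up to a constant, so the
   directions are determined by the n + (number of augmenting edges) remaining
   coordinates.  Lower bound: along a path, every augmenting edge provides one more
   affinely independent sequence, and the sequences following a given path form a
   convex set.  Finally a path splits into simple cycles and a remainder of bounded
   length, so that d(k) = H k + O(1) with H the maximal ratio. *)
Require Import Defs.
From mathcomp Require Import all_boot all_order all_algebra.
From mathcomp Require Import all_classical all_reals all_analysis.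
From mathcomp Require Import zify ring lra.
Import Order.TTheory GRing.Theory Num.Theory.
Import numFieldNormedType.Exports.
Local Open Scope classical_set_scope.
Local Open Scope ring_scope.
Set Implicit Arguments.
Unset Strict Implicit.
Unset Printing Implicit Defensive.

(** * Position of real numbers with respect to the integers *)

(** Equivalent to equal floors together with equal integrality. The form with all integer
    comparisons makes negation and integer translation immediate. *)
Definition same_position (R : realType) (x y : R) : Prop :=
  forall c : int,
    (x <= c%:~R) = (y <= c%:~R) /\ (c%:~R <= x) = (c%:~R <= y).

Section SamePosition.
Variable R : realType.
Implicit Types x y z : R.

Lemma same_positionN x y : same_position x y -> same_position (- x) (- y).
Proof.
move=> xy c; have [H1 H2] := xy (- c); rewrite !mulrNz in H1 H2.
by split; [rewrite [LHS]lerNl H2 [RHS]lerNl | rewrite [LHS]lerNr H1 [RHS]lerNr].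
Qed.

Lemma same_positionDz x y (d : int) :
  same_position x y -> same_position (x + d%:~R) (y + d%:~R).
Proof.
move=> xy c; have [H1 H2] := xy (c - d); rewrite !intrB in H1 H2.
by split; rewrite -?lerBrDr ?H1 // -!lerBlDr H2.
Qed.

Lemma same_position_lt x y (c : int) : same_position x y ->
  (x < c%:~R) = (y < c%:~R) /\ (c%:~R < x) = (c%:~R < y).
Proof. by move=> /(_ c)[H1 H2]; rewrite !ltNge H1 H2. Qed.

Lemma same_position_floor x y : same_position x y ->
  Num.floor x = Num.floor y /\ (x \is a Num.int) = (y \is a Num.int).
Proof.
move=> xy; have fxy : Num.floor x = Num.floor y.
  apply/eqP; rewrite floor_eq; have /andP[] := floor_itv y.
  have [_ ->] := xy (Num.floor y).
  by have [-> _] := same_position_lt (Num.floor y + 1) xy => -> ->.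
split=> //; rewrite !intrEfloor fxy !eq_le.
by have [-> ->] := xy (Num.floor y).
Qed.

Lemma floor_same_position x y : Num.floor x = Num.floor y ->
  (x \is a Num.int) = (y \is a Num.int) -> same_position x y.
Proof.
move=> fxy ixy c; split; last by rewrite -!floor_ge_int fxy.
have := ixy; rewrite !intrEfloor fxy => H.
rewrite !le_eqVlt -!floor_lt_int fxy; congr (_ || _).
apply/eqP/eqP => E.
- by move: H; rewrite E -fxy E intrKfloor eqxx => /esym/eqP ->.
- by move: H; rewrite E intrKfloor eqxx => /eqP ->.
Qed.

End SamePosition.

(** * Cells cut out by integer comparisons of coordinate differences *)

Section Polyh.
Variables (R : realType) (n : nat) (a : 'I_n.+1 -> int).
Implicit Types (v w : vertex n) (y z : 'rV[R]_n).

(** With [ve] false the difference is the integer [vm]; with [ve] true it lies strictly between [vm]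
    and [vm + 1]. Both cases prescribe floor and integrality. *)
Lemma polyhP v y : polyh a v y <->
  [/\ forall j, y 0 (vs v) <= y 0 j,
      forall r l, r \in vB v -> l \in vB v -> (r < l)%N ->
        vm v r l = Num.floor (y 0 r - y 0 l) /\
        ve v r l = (y 0 r - y 0 l \isn't a Num.int)
    & forall j, j \notin vB v ->
      (j.+1%:Z * spread a)%:~R < y 0 j - y 0 (vs v)].
Proof.
split=> [[H1 H2 H3 H4]|[H1 H2 H4]]; split=> //.
- move=> r l rB lB rl; case E: (ve v r l).
    have /andP[A B] := H3 r l rB lB rl E.
    have F : Num.floor (y 0 r - y 0 l) = vm v r l.
      by apply: floor_def; rewrite intrD1; lra.
    by rewrite intrEfloor F; split=> //; rewrite lt_eqF //; lra.
  have A := H2 r l rB lB rl (negbT E).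
  have -> : y 0 r - y 0 l = (vm v r l)%:~R by lra.
  by rewrite intrKfloor intr_int.
- move=> r l rB lB rl nE; have [-> E] := H2 r l rB lB rl.
  by move: nE; rewrite E negbK intrEfloor => /eqP ->; lra.
- move=> r l rB lB rl nE; have [-> E] := H2 r l rB lB rl.
  have := floor_itv (y 0 r - y 0 l); rewrite intrD1 => /andP[A B].
  move: nE; rewrite E intrEfloor => C.
  have : (Num.floor (y 0 r - y 0 l))%:~R < y 0 r - y 0 l by rewrite lt_neqAle C A.
  by move=> ?; lra.
Qed.

(** Both points lie in the same face of the arrangement of hyperplanes [y_r - y_l = c] with [c] an
    integer and [r], [l] in [B]. *)
Definition same_cell (B : {set 'I_n}) y z : Prop :=
  forall r l, r \in B -> l \in B ->
    same_position (y 0 r - y 0 l) (z 0 r - z 0 l).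

Lemma same_cell_lt (B : {set 'I_n}) y z :
  (forall r l, r \in B -> l \in B -> (r < l)%N ->
    same_position (y 0 r - y 0 l) (z 0 r - z 0 l)) -> same_cell B y z.
Proof.
move=> H r l rB lB; case: (ltngtP r l) => [rl|lr|/val_inj ->].
- exact: H.
- by rewrite -opprB -[_ - z 0 l]opprB; exact/same_positionN/H.
- by rewrite !subrr.
Qed.

Lemma polyh_same_cell v y z : polyh a v y -> polyh a v z -> same_cell (vB v) y z.
Proof.
move=> /polyhP[_ Hy _] /polyhP[_ Hz _].
apply: same_cell_lt => r l rB lB rl.
have [y1 y2] := Hy r l rB lB rl; have [z1 z2] := Hz r l rB lB rl.
apply: floor_same_position; first by rewrite -y1 z1.
by apply/negb_inj; rewrite -y2 z2.
Qed.

Lemma same_cell_le (B : {set 'I_n}) y z r l (c d : int) : same_cell B y z ->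
  r \in B -> l \in B ->
  (y 0 r + c%:~R <= y 0 l + d%:~R) = (z 0 r + c%:~R <= z 0 l + d%:~R).
Proof.
move=> H rB lB; have [E _] := H r l rB lB (d - c).
have F (x x' : R) : (x + c%:~R <= x' + d%:~R) = (x - x' <= (d - c)%:~R).
  by rewrite intrB; apply/idP/idP; lra.
by rewrite !F.
Qed.

Lemma same_cell_le0 (B : {set 'I_n}) y z r l : same_cell B y z ->
  r \in B -> l \in B -> (y 0 r <= y 0 l) = (z 0 r <= z 0 l).
Proof.
by move=> H rB lB; have := same_cell_le 0 0 H rB lB; rewrite !addr0.
Qed.

Lemma first_min_same_cell (B : {set 'I_n}) y z s : same_cell B y z ->
  first_min B y s -> first_min B z s.
Proof.
move=> H [sB H1 H2]; split=> // i iB.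
  by rewrite -(same_cell_le0 H sB iB); exact: H1.
by move=> /(H2 i iB); rewrite !ltNge (same_cell_le0 H iB sB).
Qed.

Lemma first_min_exists (B : {set 'I_n}) y i0 : i0 \in B ->
  exists s, first_min B y s.
Proof.
move=> i0B.
pose s1 := [arg min_(i < i0 in B) y 0 i]%O.
have [s1B s1min] : s1 \in B /\ forall j, j \in B -> y 0 s1 <= y 0 j.
  by rewrite /s1; case: Order.TotalTheory.arg_minP.
pose P := [pred i | (i \in B) && (y 0 i == y 0 s1)].
have P1 : P s1 by rewrite /= s1B eqxx.
pose s := [arg min_(i < s1 | P i) val i]%N.
have [/andP[sB /eqP sE] smin] : P s /\ forall j, P j -> (s <= j)%N.
  by rewrite /s; case: arg_minnP.
exists s; split=> // i iB; rewrite sE; first exact: s1min.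
move=> lt; rewrite lt_neqAle s1min // andbT; apply/negP => /eqP E.
by have := smin i; rewrite /= iB -E eqxx => /(_ isT); rewrite leqNgt lt.
Qed.

Lemma spread_ge (i j : 'I_n.+1) : a i - a j <= spread a.
Proof. by rewrite /spread lerB // ?le_bigmax // bigmin_le. Qed.

Lemma spread_ge0 : 0 <= spread a.
Proof. by have := spread_ge ord0 ord0; rewrite subrr. Qed.

End Polyh.

(** * Windows and vertices *)

Section Steps.
Variables (R : realType) (n : nat) (a : 'I_n.+1 -> int).
Implicit Types (v w : vertex n) (y z : 'rV[R]_n) (x : R).

Local Notation M := ((spread a)%:~R : R).
Local Notation A i := ((coef a i)%:~R : R).
Local Notation an := ((a ord_max)%:~R : R).

Lemma spreadR_ge0 : 0 <= M.
Proof. by rewrite ler0z spread_ge0. Qed.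

Lemma spreadR_ge (i j : 'I_n.+1) : (a i)%:~R - (a j)%:~R <= M.
Proof. by rewrite -intrB ler_int spread_ge. Qed.

Lemma extend_widen y x (i : 'I_n) : extend y x 0 (widen_ord (leqnSn n) i) = y 0 i.
Proof.
have -> : widen_ord (leqnSn n) i = lift ord_max i.
  by apply: val_inj; rewrite /= /bump leqNgt ltn_ord.
by rewrite mxE liftK.
Qed.

Lemma extend_max y x : extend y x 0 ord_max = x.
Proof. by rewrite mxE unlift_none. Qed.

Lemma ord_maxVwiden (i : 'I_n.+1) :
  i = ord_max \/ exists j, i = widen_ord (leqnSn n) j.
Proof.
case: (unliftP ord_max i) => [j ->|->]; [right; exists j | by left].
by apply: val_inj; rewrite /= /bump leqNgt ltn_ord.
Qed.

Lemma push_next y x (i j : 'I_n) : j = i.+1 :> nat -> push y x 0 i = y 0 j.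
Proof.
move=> ji; rewrite mxE -(extend_widen y x j); congr (extend y x 0 _).
by apply: val_inj; rewrite /= /bump leq0n add1n -ji.
Qed.

Lemma push_last y x (i : 'I_n) : i.+1 = n -> push y x 0 i = x.
Proof.
move=> iE; rewrite mxE -[RHS](extend_max y x); congr (extend y x 0 _).
by apply: val_inj; rewrite /= /bump leq0n add1n iE.
Qed.

Lemma mem_Bminus (B : {set 'I_n}) (i j : 'I_n) : j = i.+1 :> nat ->
  (i \in Bminus B) = (j \in B).
Proof.
move=> ji; rewrite inE; apply/existsP/idP => [[k /andP[kB /eqP ki]]|jB].
  by rewrite (_ : j = k) //; apply: val_inj; rewrite /= ji ki.
by exists j; rewrite jB ji eqxx.
Qed.

Lemma BminusP (B : {set 'I_n}) (i : 'I_n) :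
  reflect (exists2 j : 'I_n, j \in B & j = i.+1 :> nat) (i \in Bminus B).
Proof.
rewrite inE; apply: (iffP existsP) => [[k /andP[kB /eqP ki]]|[j jB ji]].
  by exists k.
by exists j; rewrite jB ji eqxx.
Qed.

(** A sequence of length n + 1 has a single window, the one with j = 0, so [w] must be the
    identity. *)
Lemma satisfies_extend y x : satisfies a (extend y x) <->
  min_attained_twice (fun i : 'I_n.+1 => extend y x 0 i + (a i)%:~R).
Proof.
split=> [/(_ 0%N id)|H j w wE]; first exact.
have j0 : j = 0%N.
  by have := wE ord_max; have := ltn_ord (w ord_max); move=> /=; lia.
suff wi i : w i = i.
  by move: H; rewrite /min_attained_twice => -[i1 [i2 H]]; exists i1, i2; rewrite !wi;
     case: H => ? H; split=> // i; rewrite wi.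
by apply: val_inj; rewrite /= wE j0.
Qed.

Lemma in_argmin y r : (r \in argmin_set a y) =
  [forall l, y 0 r + A r <= y 0 l + A l].
Proof. by rewrite inE. Qed.

Lemma argmin_exists y (i0 : 'I_n) : exists t, t \in argmin_set a y.
Proof.
pose t := [arg min_(i < i0) (y 0 i + A i)]%O.
exists t; rewrite in_argmin; apply/forallP => l; rewrite /t.
by case: Order.TotalTheory.arg_minP => // i _ ->.
Qed.

Lemma argmin_le y t l : t \in argmin_set a y -> y 0 t + A t <= y 0 l + A l.
Proof. by rewrite in_argmin => /forallP. Qed.

(** Were the new term strictly below the minimum of the old ones, the minimum would be attained at
    the last position only. *)
Lemma satisfies_ge y x t : t \in argmin_set a y ->
  satisfies a (extend y x) -> y 0 t + A t <= x + an.
Proof.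
move=> tS /satisfies_extend[i1 [i2 [i12 H]]].
rewrite leNgt; apply/negP => lt.
have E i : (extend y x 0 i + (a i)%:~R <= x + an) -> i = ord_max.
  case: (ord_maxVwiden i) => [//|[j ->]]; rewrite extend_widen => le.
  by have := argmin_le j tS; rewrite /coef in lt * => ?; exfalso; lra.
have [] := H ord_max; rewrite extend_max => /E e1 /E e2.
by move: i12; rewrite e1 e2 eqxx.
Qed.

(** A single old minimiser leaves the new term as the only possible second one, which fixes x. *)
Lemma satisfies1 y x t : argmin_set a y = [set t]%SET ->
  satisfies a (extend y x) <-> x = y 0 t + A t - an.
Proof.
move=> St; have tS : t \in argmin_set a y by rewrite St set11.
split=> [sat|->].
  have ge := satisfies_ge tS sat.
  move: sat => /satisfies_extend[i1 [i2 [i12 H]]].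
  suff : x + an <= y 0 t + A t by lra.
  have [H1 H2] := H ord_max; rewrite !extend_max in H1 H2.
  have [H3 H4] := H (widen_ord (leqnSn n) t); rewrite !extend_widen in H3 H4.
  case: (ord_maxVwiden i1) => [i1E|[j1 i1E]].
    by move: H3; rewrite i1E extend_max.
  case: (ord_maxVwiden i2) => [i2E|[j2 i2E]].
    by move: H4; rewrite i2E extend_max.
  have E j : (y 0 j + A j <= y 0 t + A t) -> j = t.
    move=> le; suff : j \in argmin_set a y by rewrite St finset.in_set1 => /eqP.
    rewrite in_argmin; apply/forallP => l; exact/(le_trans le)/argmin_le.
  move: H3 H4; rewrite i1E i2E !extend_widen => /E e1 /E e2.
  by move: i12; rewrite i1E i2E e1 e2 eqxx.
apply/satisfies_extend; exists (widen_ord (leqnSn n) t), ord_max; split.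
  by rewrite -val_eqE /= neq_ltn ltn_ord.
move=> i; rewrite extend_widen extend_max.
case: (ord_maxVwiden i) => [->|[j ->]]; rewrite ?extend_max ?extend_widen.
  by rewrite /coef; split; lra.
by have := argmin_le j tS; rewrite /coef; split; lra.
Qed.

(** Two old minimisers already realise the tie, so the new term only has to stay at or above the
    minimum. *)
Lemma satisfies2 y x t : (2 <= #|argmin_set a y|)%N -> t \in argmin_set a y ->
  satisfies a (extend y x) <-> y 0 t + A t <= x + an.
Proof.
move=> S2 tS; split=> [|le]; first exact: satisfies_ge.
have [t1 [t2 [t1S t2S t12]]] : exists t1 t2, [/\ t1 \in argmin_set a y,
    t2 \in argmin_set a y & t1 != t2].
  by have /card_gt1P[t1 [t2 [? ? ?]]] := S2; exists t1, t2.
have e1 := argmin_le t t1S; have e2 := argmin_le t t2S.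
apply/satisfies_extend.
exists (widen_ord (leqnSn n) t1), (widen_ord (leqnSn n) t2); split.
  by rewrite -val_eqE.
move=> i; rewrite !extend_widen -/(coef a t1) -/(coef a t2).
case: (ord_maxVwiden i) => [->|[j ->]]; rewrite ?extend_max ?extend_widen.
  by split; lra.
by have := argmin_le j t1S; have := argmin_le j t2S; rewrite /coef; split; lra.
Qed.

Lemma argmin_set1V2 y (i0 : 'I_n) :
  (exists t, argmin_set a y = [set t]%SET) \/ (2 <= #|argmin_set a y|)%N.
Proof.
have [t tS] := argmin_exists y i0.
have : (0 < #|argmin_set a y|)%N by apply/card_gt0P; exists t.
case E: #|argmin_set a y| => [|[|k]] // _; [left | by right].
by apply/finset.cards1P; rewrite E.
Qed.

Lemma argmin_positive y : (2 <= #|argmin_set a y|)%N ->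
  exists2 t, t \in argmin_set a y & (0 < t)%N.
Proof.
move=> /card_gt1P[u [u' [uS u'S uu']]].
case: (posnP u) => [u0|up]; last by exists u.
exists u' => //; rewrite lt0n; apply: contra uu' => /eqP u'0.
by apply/eqP/val_inj; rewrite /= u0 u'0.
Qed.

(** An unbounded coordinate exceeds the minimum by more than M, since the factor [j.+1] of the
    0-based index is at least 1, while two coefficients differ by at most M. *)
Lemma argmin_bounded v y r : polyh a v y -> r \in argmin_set a y -> r \in vB v.
Proof.
move=> [_ _ _ H] rS; apply: contraT => /H; rewrite intrM -pmulrn -natr1 mulrDl.
have := argmin_le (vs v) rS; have := spreadR_ge0; have := spreadR_ge
  (widen_ord (leqnSn n) (vs v)) (widen_ord (leqnSn n) r).
rewrite /coef => A1 A2 A3.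
have : 0 <= r%:R * M by rewrite mulr_ge0 // ler0n.
by lra.
Qed.

(** A minimiser at one point and a minimiser at another are both bounded indices, so the comparison
    between their terms is an integer comparison of a bounded difference, constant on the cell. *)
Lemma argmin_const v y z : vs v \in vB v -> polyh a v y -> polyh a v z ->
  argmin_set a y = argmin_set a z.
Proof.
move=> sB; suff sub (u u' : 'rV[R]_n) : polyh a v u -> polyh a v u' ->
    {subset argmin_set a u <= argmin_set a u'}.
  by move=> Hy Hz; apply/setP => r; apply/idP/idP; exact: sub.
move=> Hu Hu' r rS; have rB := argmin_bounded Hu rS.
have SB := polyh_same_cell Hu Hu'.
have [t tS] := argmin_exists u' r; have tB := argmin_bounded Hu' tS.
have := argmin_le t rS; rewrite (same_cell_le _ _ SB rB tB) => le.
rewrite in_argmin; apply/forallP => l; exact/(le_trans le)/argmin_le.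
Qed.

Definition vertex_at (B : {set 'I_n}) y s : vertex n :=
  Vertex B s
    (\matrix_(r, l) if [&& r \in B, l \in B & (r < l)%N]
                    then Num.floor (y 0 r - y 0 l) else 0)
    (\matrix_(r, l) ([&& r \in B, l \in B & (r < l)%N]
                    && (y 0 r - y 0 l \isn't a Num.int))).

Lemma vertex_at_polyh B y s : first_min B y s ->
  (forall j, j \notin B -> j.+1%:R * M < y 0 j - y 0 s) ->
  polyh a (vertex_at B y s) y.
Proof.
move=> [sB smin _] unb; apply/polyhP; split=> /= [j|r l rB lB rl|j jB].
- have [jB|/unb] := boolP (j \in B); first exact: smin.
  have : 0 <= j.+1%:R * M by rewrite mulr_ge0 ?ler0n ?spreadR_ge0.
  by lra.
- by rewrite !mxE rB lB rl.
- by rewrite intrM -pmulrn; exact: unb.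
Qed.

Lemma vertex_at_is_vertex B y s : first_min B y s ->
  (forall j, j \notin B -> j.+1%:R * M < y 0 j - y 0 s) ->
  (forall q, q \in B -> (s < q)%N -> y 0 q - y 0 s <= n%:R * M) ->
  (forall p, p \in B -> (p < s)%N ->
    y 0 p - y 0 s < (n%:R + s%:R - p%:R) * M + 1) ->
  (forall r l, r \in B -> l \in B -> (r < l)%N ->
    - (2 * n%:R * M) <= y 0 r - y 0 l < 2 * n%:R * M + 1) ->
  is_vertex R a (vertex_at B y s).
Proof.
move=> smin unb Hq Hp Hrl; have Py := vertex_at_polyh smin unb.
have [sB _ _] := smin.
split=> //=; last 2 first.
- by exists y.
- by move=> z Pz; apply: first_min_same_cell (polyh_same_cell Py Pz) smin.
- split=> [q qB sq|p pB ps|r l rB lB rl]; rewrite !mxE ?rB ?lB ?qB ?pB ?sB ?sq ?ps ?rl.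
  + by rewrite floor_ge_int mulrNz intrM -pmulrn; have := Hq q qB sq; lra.
  + rewrite -ltzD1 floor_lt_int intrD1 intrM -pmulrn natrB; last by lia.
    by rewrite natrD; exact: Hp.
  + have /andP[A1 A2] := Hrl r l rB lB rl.
    rewrite ler_norml floor_ge_int -ltzD1 floor_lt_int intrD1 mulrNz !intrM.
    by rewrite -pmulrn A1 A2.
- by move=> r l nrl; rewrite !mxE (negbTE nrl).
Qed.

Lemma vertex_bounds v y : is_vertex R a v -> polyh a v y ->
  [/\ forall q, q \in vB v -> (vs v <= q)%N -> y 0 q - y 0 (vs v) <= n%:R * M,
      forall p, p \in vB v -> (p < vs v)%N ->
        y 0 p - y 0 (vs v) < (n%:R + (vs v)%:R - p%:R) * M + 1
    & forall r l, r \in vB v -> l \in vB v -> (r < l)%N ->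
        - (2 * n%:R * M) <= y 0 r - y 0 l < 2 * n%:R * M + 1].
Proof.
move=> [sB [Hq Hp Hrl] _ _ _] /polyhP[_ Hm _]; split.
- move=> q qB; rewrite leq_eqVlt => /predU1P[/val_inj <-|sq].
    by rewrite subrr mulr_ge0 ?ler0n ?spreadR_ge0.
  have := Hq q qB sq; have [-> _] := Hm _ _ sB qB sq.
  by rewrite floor_ge_int mulrNz intrM -pmulrn; lra.
- move=> p pB ps; have := Hp p pB ps; have [-> _] := Hm _ _ pB sB ps.
  rewrite -ltzD1 floor_lt_int intrD1 intrM -pmulrn natrB; last by lia.
  by rewrite natrD.
- move=> r l rB lB rl; have := Hrl r l rB lB rl; have [-> _] := Hm _ _ rB lB rl.
  by rewrite ler_norml floor_ge_int -ltzD1 floor_lt_int intrD1 mulrNz !intrM -pmulrn.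
Qed.

End Steps.

(** * Every continuation follows an edge *)

Lemma ord_predecessor n (t : 'I_n) : (0 < t)%N -> exists t' : 'I_n, t = t'.+1 :> nat.
Proof.
move=> t0; have lt : (t.-1 < n)%N by apply: leq_ltn_trans (ltn_ord t); exact: leq_pred.
by exists (Ordinal lt); rewrite /= prednK.
Qed.

Lemma ord_lastVnext n (j : 'I_n) : (j.+1 < n)%N \/ j.+1 = n.
Proof.
have : (j.+1 <= n)%N := ltn_ord j.
by rewrite leq_eqVlt => /orP[/eqP|]; [right | left].
Qed.

Lemma last_ord_max n (i j : 'I_n) : i.+1 = n -> (i < j)%N -> False.
Proof. by move=> iE; have := ltn_ord j; lia. Qed.

Lemma last_ord_unique n (i j : 'I_n) : i.+1 = n -> j.+1 = n -> i = j.
Proof. by move=> iE jE; apply: val_inj => /=; lia. Qed.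

Lemma Bminus_lt_last n (B : {set 'I_n}) (r l : 'I_n) :
  r \in Bminus B -> l.+1 = n -> (r < l)%N.
Proof. by move=> /BminusP[j _ jr] ln; have := ltn_ord j; lia. Qed.

Section Edges.
Variables (R : realType) (n : nat) (a : 'I_n.+1 -> int).
Implicit Types (v w : vertex n) (y z : 'rV[R]_n) (x : R).

Local Notation M := ((spread a)%:~R : R).
Local Notation A i := ((coef a i)%:~R : R).
Local Notation an := ((a ord_max)%:~R : R).

Lemma spreadR_mono (i j : nat) : (i <= j)%N -> i%:R * M <= j%:R * M.
Proof. by move=> ij; rewrite ler_wpM2r ?spreadR_ge0 ?ler_nat. Qed.

(** Coordinate j is declared bounded exactly when it lies within (j + 1) M of the minimum, which
    makes the condition on unbounded coordinates automatic. *)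
Lemma exists_vertex (hn : (0 < n)%N) y : exists2 v, is_vertex R a v & polyh a v y.
Proof.
have [s [_ smin sfirst]] := first_min_exists y (finset.in_setT (Ordinal hn)).
pose B : {set 'I_n} := [set j | y 0 j - y 0 s <= j.+1%:R * M]%SET.
have sB : s \in B by rewrite finset.inE subrr mulr_ge0 ?ler0n ?spreadR_ge0.
have Bs : first_min B y s.
  by split=> // i _; [exact: smin | move=> ?; exact: sfirst].
have unb j : j \notin B -> j.+1%:R * M < y 0 j - y 0 s.
  by rewrite finset.inE -ltNge.
have bnd j : j \in B -> y 0 j - y 0 s <= n%:R * M.
  rewrite finset.inE => /le_trans; apply; exact: spreadR_mono.
have M0 := spreadR_ge0 R a.
exists (vertex_at B y s); last exact: vertex_at_polyh.
apply: vertex_at_is_vertex => //.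
- by move=> q qB _; exact: bnd.
- move=> p pB ps; have := bnd p pB; have := spreadR_mono (ltnW ps).
  by lra.
- move=> r l rB lB _; have := bnd r rB; have := bnd l lB.
  have := smin r (finset.in_setT _); have := smin l (finset.in_setT _).
  have : 0 <= n%:R * M by rewrite mulr_ge0 ?ler0n.
  by move=> *; apply/andP; split; lra.
Qed.

(** The shift lowers the index by one and hence the threshold by M, which pays for the reference
    coordinate [s] lying up to M above the old minimum. *)
Lemma push_unbounded v y x (j s : 'I_n) : polyh a v y ->
  push y x 0 s <= y 0 (vs v) + M -> j \notin Bminus (vB v) -> (j.+1 < n)%N ->
  j.+1%:R * M < push y x 0 j - push y x 0 s.
Proof.
move=> [_ _ _ unb] slow jB jn.
have jB' : Ordinal jn \notin vB v by rewrite -(@mem_Bminus _ _ j (Ordinal jn)).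
have := unb _ jB'; rewrite (@push_next _ _ y x j (Ordinal jn)) // intrM -pmulrn.
by rewrite -[(Ordinal jn).+1]/(j.+2) -(natr1 j.+1) mulrDl; lra.
Qed.

(** Common core of the three kinds of edges: the shifted point determines the vertex [w], and the
    size bounds on [vm] survive the shift. The hypotheses on x say that it does not drop more than M
    below the old minimum and lies on the side of n M prescribed by whether the last index belongs
    to [B]. *)
Lemma step_vertex v y x (B : {set 'I_n}) s :
  is_vertex R a v -> polyh a v y ->
  B = Bminus (vB v) \/ B = (Bminus (vB v) :|: last_index n)%SET ->
  y 0 (vs v) - M <= x ->
  first_min B (push y x) s ->
  push y x 0 s <= y 0 (vs v) + M ->
  (forall l r : 'I_n, l.+1 = n -> l \in B -> r \in Bminus (vB v) ->
    x <= push y x 0 r + n%:R * M) ->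
  (forall l : 'I_n, l.+1 = n -> l \notin B -> n%:R * M < x - push y x 0 s) ->
  let w := vertex_at B (push y x) s in
  [/\ is_vertex R a w, inherits v w & polyh a w (push y x)].
Proof.
move=> vV yv BE xlow smin slow xup xunb w.
have [sB sle sfirst] := smin.
have M0 := spreadR_ge0 R a.
have [v1 _ _ v2] := yv.
have v3 : first_min (vB v) y (vs v) by case: vV => _ _ _ _; exact.
have [svB _ vfirst] := v3.
have [Uq Up Url] := vertex_bounds vV yv.
have BmB i : i \in Bminus (vB v) -> i \in B.
  by case: BE => -> // iB; rewrite finset.inE iB.
have memB i : i \in B -> (exists2 j : 'I_n, j \in vB v & j = i.+1 :> nat) \/ i.+1 = n.
  case: BE => -> ; first by move/BminusP; left.
  by rewrite finset.inE => /orP[/BminusP|]; [left | rewrite finset.inE => /eqP; right].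
have below (j i : 'I_n) : j = i.+1 :> nat -> j \in vB v -> push y x 0 s <= y 0 j.
  move=> ji jB; rewrite -(push_next y x ji); apply: sle; apply: BmB.
  by rewrite (mem_Bminus _ ji).
(* If some index precedes the old first minimum, that minimum is not at position 0 and survives the
   shift; the new minimum, taken at its old index [j0], is then not larger and cannot come
   earlier. *)
have early (j j0 : 'I_n) :
    j0 = s.+1 :> nat -> j0 \in vB v -> (j < vs v)%N -> (vs v <= j0)%N.
  move=> j0s j0B jv.
  have [i iE] : exists i : 'I_n, vs v = i.+1 :> nat.
    by apply: ord_predecessor; apply: leq_ltn_trans jv.
  have := below _ _ iE svB; rewrite (push_next y x j0s) => le.
  by rewrite leqNgt; apply/negP => /(vfirst _ j0B); lra.
have unb j : j \notin B -> j.+1%:R * M < push y x 0 j - push y x 0 s.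
  move=> jB; have [jn|jn] := ord_lastVnext j.
  - by apply: push_unbounded yv slow _ jn; apply: contra jB; exact: BmB.
  - by rewrite push_last // jn; exact: xunb jn jB.
have mono_s : (vs v)%:R * M + M <= n%:R * M.
  by have := spreadR_mono (ltn_ord (vs v)); rewrite -natr1 mulrDl mul1r.
have mono_j (j : 'I_n) : j%:R * M + M <= n%:R * M.
  by have := spreadR_mono (ltn_ord j); rewrite -natr1 mulrDl mul1r.
have Mn0 (j : nat) : 0 <= j%:R * M by rewrite mulr_ge0 ?ler0n.
split; last exact: vertex_at_polyh.
- apply: vertex_at_is_vertex => //.
  + move=> q qB sq; case: (memB q qB) => [[j jB jq]|qn].
      have [j0 j0B j0s] : exists2 j : 'I_n, j \in vB v & j = s.+1 :> nat.
        by case: (memB s sB) => // sn; case: (last_ord_max sn sq).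
      rewrite (push_next y x jq) (push_next y x j0s).
      case: (leqP (vs v) j) => [vj|jv].
        by have := Uq _ jB vj; have := v1 j0; lra.
      have := leq_trans jv (early _ _ j0s j0B jv).
      by rewrite jq j0s ltnS ltnNge (ltnW sq).
    have sBm : s \in Bminus (vB v).
      by case: (memB s sB) => [/BminusP //|sn]; case: (last_ord_max sn sq).
    by have := xup q s qn qB sBm; rewrite (push_last _ _ qn); lra.
  + move=> q qB qs; case: (memB q qB) => [[j jB jq]|qn]; last first.
      by case: (last_ord_max qn qs).
    rewrite (push_next y x jq).
    case: (memB s sB) => [[j0 j0B j0s]|sn].
      rewrite (push_next y x j0s); have := v1 j0.
      have sE : s%:R = j0%:R - 1 :> R by rewrite j0s -natr1; lra.
      have qE : q%:R = j%:R - 1 :> R by rewrite jq -natr1; lra.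
      rewrite sE qE => v1j0.
      case: (leqP (vs v) j) => [vj|jv].
        have := Uq _ jB vj; have : j%:R * M <= j0%:R * M.
          by apply: spreadR_mono; rewrite jq j0s ltnS ltnW.
        by lra.
      have vj0 := early _ _ j0s j0B jv; have := spreadR_mono vj0.
      by have := Up _ jB jv; lra.
    (* The new term is the minimum here and may lie M below the old one; in both cases below an
       index plus one is at most n, which absorbs the extra M. *)
    rewrite (push_last _ _ sn).
    have sE : s%:R = n%:R - 1 :> R by rewrite -[in RHS]sn -natr1; lra.
    have qE : q%:R = j%:R - 1 :> R by rewrite jq -natr1; lra.
    rewrite sE qE.
    case: (leqP (vs v) j) => [vj|jv].
      by have := Uq _ jB vj; have := mono_j j; lra.
    by have := Up _ jB jv; lra.
  + move=> r l rB lB rl; case: (memB r rB) => [[i iB ir]|rn]; last first.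
      by case: (last_ord_max rn rl).
    case: (memB l lB) => [[j jB jl]|ln].
      rewrite (push_next y x ir) (push_next y x jl); apply: Url => //.
      by rewrite ir jl ltnS.
    have rBm : r \in Bminus (vB v) by apply/BminusP; exists i.
    have := xup l r ln lB rBm; rewrite (push_last _ _ ln) (push_next y x ir) => xle.
    have := Mn0 n; have := mono_j i; have := Mn0 i => n1 n2 n3.
    apply/andP; split; first by lra.
    case: (leqP (vs v) i) => [vi|iv].
      by have := Uq _ iB vi; lra.
    by have := Up _ iB iv; lra.
- move=> r l r' l' rB lB rl rr ll; rewrite [vm w _ _]mxE [ve w _ _]mxE.
  rewrite (BmB r') ?(BmB l') ?(mem_Bminus _ rr) ?(mem_Bminus _ ll) //.
  have -> : (r' < l')%N by move: rl; rewrite rr ll ltnS.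
  rewrite (push_next y x rr) (push_next y x ll) /=.
  by have /polyhP[_ /(_ r l rB lB rl)[-> ->] _] := yv.
Qed.

Lemma push_Bminus (B : {set 'I_n}) (i : 'I_n) y x x' : i \in Bminus B ->
  push y x 0 i = push y x' 0 i.
Proof. by move=> /BminusP[j _ ji]; rewrite !(push_next _ _ ji). Qed.

Lemma eq_first_min (B : {set 'I_n}) y z s :
  (forall i, i \in B -> y 0 i = z 0 i) -> first_min B y s -> first_min B z s.
Proof.
by move=> yz [sB H1 H2]; split=> // i iB; rewrite -!yz //; [exact: H1 | exact: H2].
Qed.

Lemma last_notin_Bminus (B : {set 'I_n}) (l : 'I_n) :
  l.+1 = n -> l \notin Bminus B.
Proof. by move=> ln; apply/negP => /BminusP[j _ jl]; have := ltn_ord j; lia. Qed.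

(** A unique minimiser gives [edge_E1]. Otherwise x is compared with the least surviving bounded
    coordinate: more than n M above it the last index becomes unbounded ([edge_E2]), and else
    bounded ([edge_E3]). *)
Lemma satisfies_edge v y x : is_vertex R a v -> polyh a v y ->
  satisfies a (extend y x) -> exists2 w, edge R a v w & polyh a w (push y x).
Proof.
move=> vV yv sat.
have [svB _ _ _ v3] := vV; have [_ _ vfirst] := v3 _ yv.
have [v1 _ _ _] := yv.
have M0 := spreadR_ge0 R a.
have hn : (0 < n)%N by case: (n) (vs v) => // -[].
have [t0 t0S] := argmin_exists a y (vs v).
have Mn : M <= n%:R * M by have := spreadR_mono hn; rewrite mul1r.
have xlow : y 0 (vs v) - M <= x.
  have := satisfies_ge t0S sat; have := v1 t0.
  have := spreadR_ge R a ord_max (widen_ord (leqnSn n) t0).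
  by rewrite /coef; lra.
have ln : (n.-1 < n)%N by rewrite prednK.
pose l0 := Ordinal ln; have l0n : l0.+1 = n by rewrite /= prednK.
have l0E (l : 'I_n) : l.+1 = n -> l = l0 by move=> lE; exact: last_ord_unique.
have lastP (l : 'I_n) : l \in last_index n -> l.+1 = n by rewrite finset.inE => /eqP.
pose B1 := (Bminus (vB v) :|: last_index n)%SET.
have l0B1 : l0 \in B1 by rewrite finset.in_setU [X in _ || X]finset.inE l0n eqxx orbT.
have [s1 s1min] := first_min_exists (push y x) l0B1.
have [s1B s1le _] := s1min.
have BB1 i : i \in Bminus (vB v) -> i \in B1 by rewrite finset.in_setU => ->.
have lastB1 (l : 'I_n) : l.+1 = n -> l \notin B1 -> n%:R * M < x - push y x 0 s1.
  by move=> /l0E ->; rewrite l0B1.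
have dA (i j : 'I_n.+1) := spreadR_ge R a i j.
have [[t tE]|S2] := argmin_set1V2 a y (vs v).
- have tS : t \in argmin_set a y by rewrite tE finset.set11.
  have xE := (satisfies1 x tE).1 sat.
  (* The forced term exceeds every coordinate by at most M; this gives both size conditions of
     [step_vertex]. *)
  have xle j : x <= y 0 j + M.
    have := argmin_le j tS; rewrite xE.
    by have := dA (widen_ord (leqnSn n) j) ord_max; rewrite /coef; lra.
  have [|r|w1 w2 w3] := step_vertex vV yv (or_intror erefl) xlow s1min _ _ lastB1.
  + by have := s1le _ l0B1; rewrite (push_last y x l0n); have := xle (vs v); lra.
  + move=> j _ _ /BminusP[i _ ij]; rewrite (push_next _ _ ij).
    by have := xle i; lra.
  exists (vertex_at B1 (push y x) s1) => //; split=> //; exists y => //.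
  apply: Or31; exists t; rewrite -xE; split=> //.
  move=> r' l rB lL; rewrite [vm _ _ _]mxE [ve _ _ _]mxE BB1 // finset.in_setU lL orbT.
  by rewrite (Bminus_lt_last rB (lastP _ lL)).
have [t [tS tpos tmin]] : exists t, [/\ t \in argmin_set a y, (0 < t)%N
    & forall r, r \in argmin_set a y -> (0 < r)%N -> (t <= r)%N].
  have [t1 t1S t1p] := argmin_positive S2.
  pose P := [pred i : 'I_n | (i \in argmin_set a y) && (0 < i)%N].
  have Pt1 : P t1 by rewrite /= t1S.
  pose t := [arg min_(i < t1 | P i) val i]%N.
  have [/andP[tS tp] tmin] : P t /\ forall j, P j -> (t <= j)%N.
    by rewrite /t; case: arg_minnP.
  by exists t; split=> // r rS rp; apply: tmin; rewrite /= rS.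
have tB := argmin_bounded yv tS.
have [t' tt'] := ord_predecessor tpos.
have t'B : t' \in Bminus (vB v) by rewrite (mem_Bminus _ tt').
have [s' s'min] := first_min_exists (push y 0) t'B.
have s'minx : first_min (Bminus (vB v)) (push y x) s'.
  by apply: eq_first_min s'min => i /push_Bminus; exact.
have [s'B s'le _] := s'minx.
(* The minimiser t is not at position 0, so it survives the shift and keeps the new minimum at most
   M above the old one. *)
have s'low : push y x 0 s' <= y 0 (vs v) + M.
  have := s'le _ t'B; rewrite (push_next y x tt').
  have := argmin_le (vs v) tS.
  have := dA (widen_ord (leqnSn n) (vs v)) (widen_ord (leqnSn n) t).
  by rewrite /coef; lra.
case: (ltP (n%:R * M) (x - push y x 0 s')) => xs'.
- have [l r lE|l|w1 w2 w3] :=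
    step_vertex vV yv (or_introl erefl) xlow s'minx s'low.
  + by rewrite (negbTE (last_notin_Bminus _ lE)).
  + by [].
  exists (vertex_at (Bminus (vB v)) (push y x) s') => //.
  by split=> //; exists y => //; apply: Or32.
have [||w1 w2 w3] := step_vertex vV yv (or_intror erefl) xlow s1min _ _ lastB1.
- by have := s1le _ (BB1 _ s'B); lra.
- by move=> l r _ _ rB; have := s'le _ rB; lra.
exists (vertex_at B1 (push y x) s1) => //; split=> //; exists y => //.
apply: Or33; split=> //; exists t, t', s'; split=> // l lL.
have lB1 : l \in B1 by rewrite finset.in_setU lL orbT.
have lE := lastP l lL.
have lt i : i \in Bminus (vB v) -> (i < l)%N.
  by move=> /Bminus_lt_last; exact.
rewrite [vm _ _ _]mxE [ve _ _ _]mxE [vm _ s' _]mxE (BB1 _ t'B) (BB1 _ s'B).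
rewrite lB1 !lt //=; split.
(* The floor plus the non-integrality indicator is the ceiling, so the condition on [vm w t' l]
   reads [y 0 t - x <= a ord_max - coef a t]. *)
- rewrite lerBrDr -ceil_floor ceil_le_int (push_next y x tt') (push_last y x lE).
  by have := satisfies_ge tS sat; rewrite intrB; lra.
- by rewrite floor_ge_int mulrNz intrM -pmulrn (push_last y x lE); lra.
Qed.
End Edges.

(** * Rigid and augmenting edges *)

Section Continuations.
Variables (R : realType) (n : nat) (a : 'I_n.+1 -> int).
Implicit Types (v w : vertex n) (y z : 'rV[R]_n) (x : R).

Local Notation M := ((spread a)%:~R : R).
Local Notation A i := ((coef a i)%:~R : R).
Local Notation an := ((a ord_max)%:~R : R).

Lemma mem_BminusVlast v w (i : 'I_n) :
  vB w = Bminus (vB v) \/ vB w = (Bminus (vB v) :|: last_index n)%SET ->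
  i \in vB w -> i \in Bminus (vB v) \/ i.+1 = n /\ (i \in last_index n).
Proof.
case=> ->; first by left.
rewrite finset.in_setU => /orP[|iL]; first by left.
by right; split=> //; move: iL; rewrite finset.inE => /eqP.
Qed.

Lemma Bminus_sub v w (i : 'I_n) :
  vB w = Bminus (vB v) \/ vB w = (Bminus (vB v) :|: last_index n)%SET ->
  i \in Bminus (vB v) -> i \in vB w.
Proof. by case=> -> //; rewrite finset.in_setU => ->. Qed.

Lemma inherits_floor v w y x r l : polyh a v y -> inherits v w ->
  r \in Bminus (vB v) -> l \in Bminus (vB v) -> (r < l)%N ->
  vm w r l = Num.floor (push y x 0 r - push y x 0 l) /\
  ve w r l = (push y x 0 r - push y x 0 l \isn't a Num.int).
Proof.
move=> /polyhP[_ Hy _] inh /BminusP[i iB ir] /BminusP[j jB jl] rl.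
have ij : (i < j)%N by rewrite ir jl ltnS.
have [-> ->] := inh i j r l iB jB ij ir jl.
by rewrite (push_next _ _ ir) (push_next _ _ jl); exact: Hy.
Qed.

Lemma inherits_same_cell v w y x z :
  vB w = Bminus (vB v) \/ vB w = (Bminus (vB v) :|: last_index n)%SET ->
  polyh a v y -> inherits v w -> polyh a w z ->
  same_cell (Bminus (vB v)) (push y x) z.
Proof.
move=> BE yv inh /polyhP[_ Hz _]; apply: same_cell_lt => r l rB lB rl.
have [z1 z2] := Hz r l (Bminus_sub BE rB) (Bminus_sub BE lB) rl.
have [y1 y2] := inherits_floor x yv inh rB lB rl.
by apply: floor_same_position; [rewrite -y1 z1 | apply/negb_inj; rewrite -y2 z2].
Qed.

(** Agreement of the differences with [vm w] and [ve w] puts the shifted point in the cell of a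
    known point of P_w, so its first minimum is [vs w]; the index [b] keeps that minimum at most M
    above the old one, as [push_unbounded] needs. *)
Lemma polyh_push v w y x (b : 'I_n) : polyh a v y -> is_vertex R a w -> inherits v w ->
  vB w = Bminus (vB v) \/ vB w = (Bminus (vB v) :|: last_index n)%SET ->
  (forall r l, l \in vB w -> r \in Bminus (vB v) -> l.+1 = n ->
     vm w r l = Num.floor (push y x 0 r - push y x 0 l) /\
     ve w r l = (push y x 0 r - push y x 0 l \isn't a Num.int)) ->
  b \in vB w -> push y x 0 b <= y 0 (vs v) + M ->
  (forall l : 'I_n, l.+1 = n -> l \notin vB w -> n%:R * M < x - push y x 0 (vs w)) ->
  polyh a w (push y x).
Proof.
move=> yv [swB _ _ [z zw] wmin] inh BE Hlast bB ble xunb.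
have Hfl r l : r \in vB w -> l \in vB w -> (r < l)%N ->
    vm w r l = Num.floor (push y x 0 r - push y x 0 l) /\
    ve w r l = (push y x 0 r - push y x 0 l \isn't a Num.int).
  move=> rB lB rl; case: (mem_BminusVlast BE rB) => [rB'|[rn _]]; last first.
    by case: (last_ord_max rn rl).
  case: (mem_BminusVlast BE lB) => [lB'|[ln _]]; last exact: Hlast.
  exact: (inherits_floor x yv inh rB' lB' rl).
have cell : same_cell (vB w) z (push y x).
  have /polyhP[_ Hz _] := zw; apply: same_cell_lt => r l rB lB rl.
  have [z1 z2] := Hz r l rB lB rl; have [y1 y2] := Hfl r l rB lB rl.
  by apply: floor_same_position; [rewrite -y1 z1 | apply/negb_inj; rewrite -y2 z2].
have [_ sle _] := first_min_same_cell cell (wmin z zw).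
have slow := le_trans (sle b bB) ble.
have unb j : j \notin vB w -> j.+1%:R * M < push y x 0 j - push y x 0 (vs w).
  move=> jB; have [jn|jn] := ord_lastVnext j.
  - by apply: push_unbounded yv slow _ jn; apply: contra jB; exact: Bminus_sub.
  - by rewrite push_last // jn; exact: xunb jn jB.
apply/polyhP; split=> // j.
  have [jB|/unb] := boolP (j \in vB w); first exact: sle.
  have : 0 <= j.+1%:R * M by rewrite mulr_ge0 ?ler0n ?spreadR_ge0.
  by lra.
by move=> /unb; rewrite intrM -pmulrn.
Qed.

Lemma argmin_low y t s : t \in argmin_set a y -> y 0 t <= y 0 s + M.
Proof.
move=> tS; have := argmin_le s tS.
have := spreadR_ge R a (widen_ord (leqnSn n) s) (widen_ord (leqnSn n) t).
by rewrite /coef; lra.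
Qed.

(** The index j and the constant c are uniform in y; the upper bound uses this to copy one
    coordinate from an earlier one. *)
Definition rigid v w : Prop := exists (j : 'I_n) (c : int),
  forall y, polyh a v y -> continuations a v w y = [set y 0 j + c%:~R].

(** Required at every point of P_v, whereas [augmenting] asks for one point; the two agree along
    edges. *)
Definition flexible v w : Prop := forall y, polyh a v y ->
  let X := continuations a v w y in [/\ open X, is_interval X & X !=set0].

(** The forced term differs from y_t by an integer, so its differences with the bounded coordinates
    have the same position at y as at y0, and the data of w are met on all of P_v. *)
Lemma edge_E1_rigid v w y0 : is_vertex R a v -> is_vertex R a w -> inherits v w ->
  polyh a v y0 -> edge_E1 a v w y0 -> rigid v w.
Proof.
move=> vV wV inh y0v [t []]; set x0 := _ - an.
move=> tE BE Hm _.
have [svB _ _ _ _] := vV.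
exists t, (coef a t - a ord_max) => y yv.
have tE' : argmin_set a y = [set t]%SET by rewrite (argmin_const svB yv y0v).
have tS : t \in argmin_set a y by rewrite tE' finset.set11.
have tB := argmin_bounded yv tS.
apply/seteqP; split=> x /=; rewrite intrB addrA.
  by case=> /(satisfies1 x tE').
move=> xE; split; first exact/(satisfies1 x tE').
have hn : (0 < n)%N by case: (n) (vs v) => // -[].
have lnB (l : 'I_n) : l.+1 = n -> l \in vB w.
  by move=> ln; rewrite BE finset.in_setU [X in _ || X]finset.inE ln eqxx orbT.
have ln : (n.-1 < n)%N by rewrite prednK.
have l0n : (Ordinal ln).+1 = n by rewrite /= prednK.
apply: (@polyh_push v w y x (Ordinal ln)) => //; first by right.
- move=> r l _ rB lE; have lL : l \in last_index n by rewrite finset.inE lE eqxx.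
  have [-> ->] := Hm r l rB lL.
  have /BminusP[j jB jr] := rB.
  rewrite !(push_last _ _ lE) !(push_next _ _ jr).
  have /(same_positionDz (a ord_max - coef a t)) := polyh_same_cell y0v yv jB tB.
  rewrite (_ : y0 0 j - x0 = y0 0 j - y0 0 t + (a ord_max - coef a t)%:~R); last first.
    by rewrite /x0 intrB; ring.
  rewrite xE (_ : y 0 j - (_ - an) =
    y 0 j - y 0 t + (a ord_max - coef a t)%:~R); last first.
    by rewrite intrB; ring.
  by move=> /same_position_floor[-> ->].
- exact: lnB.
- rewrite (push_last _ _ l0n) xE; have := argmin_le (vs v) tS.
  have := spreadR_ge R a (widen_ord (leqnSn n) (vs v)) ord_max.
  by rewrite /coef; lra.
- by move=> l /lnB ->.
Qed.

(** Leaving the last index unbounded means exactly that x lies more than n M above the new minimum,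
    an open ray; there the recurrence holds by itself because n M >= M. *)
Lemma edge_E2_flexible v w y0 : is_vertex R a v -> is_vertex R a w -> inherits v w ->
  polyh a v y0 -> edge_E2 a v w y0 -> flexible v w.
Proof.
move=> vV wV inh y0v [S2 BE s'min] y yv X; rewrite {}/X.
have [svB _ _ _ _] := vV.
have M0 := spreadR_ge0 R a.
rewrite (argmin_const svB y0v yv) in S2.
have [t tS tpos] := argmin_positive S2.
have tB := argmin_bounded yv tS.
have [t' tt'] := ord_predecessor tpos.
have t'B : t' \in Bminus (vB v) by rewrite (mem_Bminus _ tt').
have BE' := or_introl BE : vB w = Bminus (vB v) \/
  vB w = (Bminus (vB v) :|: last_index n)%SET.
have s'B : vs w \in Bminus (vB v) by case: s'min.
have /BminusP[s1 s1B s1s] := s'B.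
have hn : (0 < n)%N by case: (n) (vs v) => // -[].
have ln : (n.-1 < n)%N by rewrite prednK.
have l0n : (Ordinal ln).+1 = n by rewrite /= prednK.
suff -> : continuations a v w y = [set` `]y 0 s1 + n%:R * M, +oo[ ].
  split; [exact: interval_open | exact: interval_is_interval | ].
  by exists (y 0 s1 + n%:R * M + 1); rewrite /= in_itv /= andbT; lra.
apply/seteqP; split=> x /=; rewrite in_itv /= andbT.
  case=> _ [_ _ _ /(_ (Ordinal ln))]; rewrite BE last_notin_Bminus // => /(_ isT).
  by rewrite (push_last _ _ l0n) (push_next _ _ s1s) l0n intrM -pmulrn; lra.
move=> xs; split.
  apply/(satisfies2 x S2 tS); have := argmin_le s1 tS.
  have := spreadR_ge R a (widen_ord (leqnSn n) s1) ord_max.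
  have := spreadR_mono R a hn; rewrite mul1r.
  by rewrite /coef; lra.
apply: (@polyh_push v w y x t') => //.
- by move=> r l; rewrite BE => lB _ /(last_notin_Bminus (vB v)); rewrite lB.
- exact: Bminus_sub BE' t'B.
- by rewrite (push_next _ _ tt'); exact: argmin_low.
- by move=> l _ _; rewrite (push_next _ _ s1s); lra.
Qed.

(** One integral difference with the last index fixes x; if there is none, x ranges over an
    intersection of open unit intervals. *)
Lemma edge_E3_dichotomy v w y0 : is_vertex R a v -> is_vertex R a w -> inherits v w ->
  polyh a v y0 -> edge_E3 a v w y0 -> rigid v w \/ flexible v w.
Proof.
move=> vV wV inh y0v [S2 BE [t [t' [s' [[tS tpos _] tt' _ Hlast]]]]].
have [svB _ _ _ _] := vV.
have BE' := or_intror BE : vB w = Bminus (vB v) \/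
  vB w = (Bminus (vB v) :|: last_index n)%SET.
have hn : (0 < n)%N by case: (n) (vs v) => // -[].
have ln : (n.-1 < n)%N by rewrite prednK.
pose l0 := Ordinal ln; have l0n : l0.+1 = n by rewrite /= prednK.
have l0E (l : 'I_n) : l.+1 = n -> l = l0 by move=> lE; exact: last_ord_unique.
have l0L : l0 \in last_index n by rewrite finset.inE l0n eqxx.
have l0B : l0 \in vB w by rewrite BE finset.in_setU l0L orbT.
have tB := argmin_bounded y0v tS.
have t'B : t' \in Bminus (vB v) by rewrite (mem_Bminus _ tt').
have lt r : r \in Bminus (vB v) -> (r < l0)%N.
  by move=> /Bminus_lt_last; exact.
have [z zw] : @polyh R _ a w !=set0 by case: wV.
have /polyhP[_ Hz _] := zw.
have [Ht' _] := Hlast _ l0L.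
(* Prescribed positions of x relative to the surviving bounded coordinates suffice: the recurrence
   is already contained in the bound [Ht'], read as a bound on a ceiling. *)
have enough y x : polyh a v y ->
    (forall r, r \in Bminus (vB v) ->
      vm w r l0 = Num.floor (push y x 0 r - x) /\
      ve w r l0 = (push y x 0 r - x \isn't a Num.int)) -> continuations a v w y x.
  move=> yv H; have tS' := tS; have S2' := S2.
  rewrite (argmin_const svB y0v yv) in tS' S2'.
  split.
    apply/(satisfies2 x S2' tS'); move: Ht'.
    have [-> ->] := H t' t'B; rewrite lerBrDr -ceil_floor ceil_le_int intrB.
    by rewrite (push_next _ _ tt'); lra.
  apply: (@polyh_push v w y x t') => //.
  - by move=> r l _ rB /[dup]/l0E -> ?; rewrite [push y x 0 l0]push_last //; exact: H.
  - exact: Bminus_sub BE' t'B.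
  - by rewrite (push_next _ _ tt'); exact: argmin_low.
  - by move=> l /l0E ->; rewrite l0B.
have cells y x r l : polyh a v y -> r \in Bminus (vB v) -> l \in Bminus (vB v) ->
    same_position (push y x 0 r - push y x 0 l) (z 0 r - z 0 l).
  by move=> yv rB lB; exact: (inherits_same_cell x BE' yv inh zw).
have necessary y x r : polyh a v y -> r \in Bminus (vB v) -> continuations a v w y x ->
    vm w r l0 = Num.floor (push y x 0 r - x) /\
    ve w r l0 = (push y x 0 r - x \isn't a Num.int).
  move=> yv rB [_ /polyhP[_ H _]].
  by have := H r l0 (Bminus_sub BE' rB) l0B (lt r rB); rewrite (push_last _ _ l0n).
have [[r rB er]|alle] : (exists2 r, r \in Bminus (vB v) & ve w r l0 = false) \/
    (forall r, r \in Bminus (vB v) -> ve w r l0 = true).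
  have [/existsP[r /andP[rB /negbTE er]]|] :=
    boolP [exists r, (r \in Bminus (vB v)) && ~~ ve w r l0].
    by left; exists r.
  rewrite negb_exists => /forallP H; right => r rB.
  by have := H r; rewrite rB /= negbK.
- left; have /BminusP[j jB jr] := rB.
  exists j, (- vm w r l0) => y yv; apply/seteqP; split=> x /=.
    move=> /(necessary y x r yv rB)[]; rewrite er => -> /esym/negbFE.
    by rewrite intrEfloor (push_next _ _ jr) => /eqP E; rewrite mulrNz; lra.
  move=> xE; apply: enough => // r2 r2B.
  have [z1 z2] := Hz r l0 (Bminus_sub BE' rB) l0B (lt r rB).
  have [-> ->] := Hz r2 l0 (Bminus_sub BE' r2B) l0B (lt r2 r2B).
  move: z2; rewrite er => /esym/negbFE; rewrite intrEfloor -z1 => /eqP zE.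
  have /(same_positionDz (vm w r l0)) := cells y x r2 r yv r2B rB.
  rewrite zE [X in same_position X _](_ : _ = push y x 0 r2 - x); last first.
    by move: xE; rewrite (push_next y x jr) mulrNz => xE'; lra.
  rewrite [X in same_position _ X](_ : _ = z 0 r2 - z 0 l0); last by ring.
  by move=> /same_position_floor[-> ->].
right => y yv X; rewrite {}/X.
(* The conditions on x are the open unit intervals ]g r - 1, g r[; whether they
   meet depends only on the cell, and they do at the point z of P_w. *)
pose g r : R := push y 0 0 r - (vm w r l0)%:~R.
pose r1 := [arg min_(i < t' in Bminus (vB v)) g i]%O.
have [r1B r1le] : r1 \in Bminus (vB v) /\ forall r, r \in Bminus (vB v) -> g r1 <= g r.
  by rewrite /r1; case: Order.TotalTheory.arg_minP.
pose r2 := [arg max_(i > t' in Bminus (vB v)) g i]%O.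
have [r2B r2le] : r2 \in Bminus (vB v) /\ forall r, r \in Bminus (vB v) -> g r <= g r2.
  by rewrite /r2; case: Order.TotalTheory.arg_maxP.
have nonint x (m : int) : m%:~R < x < m%:~R + 1 ->
    m = Num.floor x /\ true = (x \isn't a Num.int).
  move=> /andP[x1 x2]; have fx : Num.floor x = m.
    by apply: floor_def; rewrite intrD1 (ltW x1).
  by rewrite intrEfloor fx lt_eqF.
have nonint' x (m : int) : m = Num.floor x -> true = (x \isn't a Num.int) ->
    m%:~R < x < m%:~R + 1.
  move=> -> /esym; rewrite intrEfloor => ne.
  by have := floor_itv x; rewrite intrD1 => /andP[A1 ->]; rewrite lt_neqAle ne A1.
suff -> : continuations a v w y = [set` `]g r2 - 1, g r1[ ].
  split; [exact: interval_open | exact: interval_is_interval | ].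
  suff lt12 : g r2 - 1 < g r1.
    by exists ((g r2 - 1 + g r1) / 2); rewrite /= in_itv /=; apply/andP; split; lra.
  have bnd r : r \in Bminus (vB v) ->
      (vm w r l0)%:~R < z 0 r - z 0 l0 < (vm w r l0)%:~R + 1.
    move=> rB; have [] := Hz r l0 (Bminus_sub BE' rB) l0B (lt r rB).
    by rewrite alle //; exact: nonint'.
  have /andP[_ b2] := bnd r2 r2B; have /andP[b1 _] := bnd r1 r1B.
  have [_ ] := same_position_lt (vm w r1 l0 - vm w r2 l0 - 1)
    (cells y 0 r1 r2 yv r1B r2B).
  rewrite !intrD !mulrNz => E'.
  have : (vm w r1 l0)%:~R - (vm w r2 l0)%:~R - 1 < z 0 r1 - z 0 r2 by lra.
  by rewrite -E' /g; lra.
apply/seteqP; split=> x /=; rewrite in_itv /=.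
  move=> xc; have H r : r \in Bminus (vB v) -> g r - 1 < x < g r.
    move=> rB; have [] := necessary y x r yv rB xc; rewrite alle // => H1 H2.
    have := nonint' _ _ H1 H2; rewrite (push_Bminus y x 0 rB) /g => /andP[A1 A2].
    by apply/andP; split; lra.
  by have /andP[-> _] := H r2 r2B; have /andP[_ ->] := H r1 r1B.
move=> /andP[x1 x2]; apply: enough => // r rB; rewrite alle //; apply: nonint.
have := r1le r rB; have := r2le r rB; rewrite (push_Bminus y x 0 rB) /g in x1 x2 *.
by move=> A1 A2; apply/andP; split; lra.
Qed.

Lemma edge_dichotomy v w : edge R a v w -> rigid v w \/ flexible v w.
Proof.
move=> [vV wV inh [y yv [|/[dup][[? ?]] |]]].
- by left; exact: edge_E1_rigid yv _.
- by right; exact: edge_E2_flexible yv _.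
- exact: edge_E3_dichotomy yv.
Qed.

End Continuations.

(** * Convex sets and polyhedra *)

Section Convexity.
Variables (R : realType).

Lemma combination_le (t x x' y y' : R) : 0 <= t <= 1 -> x <= x' -> y <= y' ->
  t * x + (1 - t) * y <= t * x' + (1 - t) * y'.
Proof.
by move=> /andP[t0 t1] xx yy; rewrite lerD // ler_wpM2l // subr_ge0.
Qed.

Lemma combination_lt (t x x' y y' : R) : 0 <= t <= 1 -> x < x' -> y < y' ->
  t * x + (1 - t) * y < t * x' + (1 - t) * y'.
Proof.
move=> /andP[t0 t1] xx yy; have [->|tn] := eqVneq t 0.
  by rewrite !mul0r !add0r subr0 !mul1r.
have tpos : 0 < t by rewrite lt_neqAle eq_sym tn.
by rewrite ltr_leD ?ltr_pM2l // ler_wpM2l ?subr_ge0 // ltW.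
Qed.

Definition is_convex (V : lmodType R) (A : set V) : Prop :=
  forall (t : R) x y, 0 <= t <= 1 -> A x -> A y -> A (t *: x + (1 - t) *: y).

(** Induction on m: all coefficients but the last are divided by their sum s, and the last point
    enters with weight 1 - s; if s = 0, only the last point remains. *)
Lemma convex_comb (V : lmodType R) (A : set V) (m : nat) (c : nat -> R) (p : nat -> V) :
  is_convex A -> (forall i, (i <= m)%N -> 0 <= c i /\ A (p i)) ->
  \sum_(i < m.+1) c i = 1 -> A (\sum_(i < m.+1) c i *: p i).
Proof.
move=> Aconv; elim: m c => [|m IH] c H.
  by rewrite !big_ord1 => ->; rewrite scale1r; exact: (H 0%N _).2.
rewrite big_ord_recr /= => S1; rewrite big_ord_recr /=.
have [cm _] := H m.+1 (leqnn _).
have s0 : 0 <= \sum_(i < m.+1) c i.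
  by apply: sumr_ge0 => i _; apply: (H i _).1; exact: ltnW (ltn_ord i).
have Am := (H m.+1 (leqnn _)).2.
have [s00|sn0] := eqVneq (\sum_(i < m.+1) c i) 0.
  have c0 i : (i < m.+1)%N -> c i = 0.
    move=> im; have /psumr_eq0P : forall i : 'I_m.+1, true -> 0 <= c i.
      by move=> j _; apply: (H j _).1; exact: ltnW (ltn_ord j).
    by move=> /(_ s00 (Ordinal im) isT).
  rewrite big1 => [|i _]; last by rewrite c0 // scale0r.
  by move: S1; rewrite s00 !add0r => ->; rewrite scale1r.
pose s := \sum_(i < m.+1) c i.
have -> : \sum_(i < m.+1) c i *: p i + c m.+1 *: p m.+1 =
    s *: (\sum_(i < m.+1) (c i / s) *: p i) + (1 - s) *: p m.+1.
  congr (_ + _ *: _); last by rewrite -S1 [X in _ = X - _]addrC addrK.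
  rewrite scaler_sumr; apply: eq_bigr => i _.
  by rewrite scalerA mulrCA divff // mulr1.
have s01 : 0 <= s <= 1 by rewrite s0 -S1 lerDl.
apply: (Aconv _ _ _ s01) => //.
apply: (IH (fun i => c i / s)) => [i im|]; last by rewrite -mulr_suml divff.
have [c0 Ai] := H i (leqW im).
by split=> //; rewrite divr_ge0.
Qed.

Lemma convex_simplex (V : lmodType R) (A : set V) (m : nat) (c : 'I_m -> R)
    (x : V) (X : 'I_m -> V) :
  is_convex A -> A x -> (forall i, A (x + X i)) ->
  (forall i, 0 <= c i) -> \sum_i c i <= 1 -> A (x + \sum_i c i *: X i).
Proof.
move=> Aconv Ax AX c0 c1.
pose C (i : nat) := if insub i is Some j then c j else 1 - \sum_i c i.
pose p (i : nat) := if insub i is Some j then x + X j else x.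
have Co (i : 'I_m) : C i = c i by rewrite /C valK.
have po (i : 'I_m) : p i = x + X i by rewrite /p valK.
have Cm : C m = 1 - \sum_i c i by rewrite /C insubF // ltnn.
have pm : p m = x by rewrite /p insubF // ltnn.
have S1 : \sum_(i < m.+1) C i = 1.
  rewrite big_ord_recr /= Cm (eq_bigr c) ?subrKC // => i _; exact: Co.
have -> : x + \sum_i c i *: X i = \sum_(i < m.+1) C i *: p i.
  have E : \sum_(i < m) C i *: p i = (\sum_i c i) *: x + \sum_i c i *: X i.
    rewrite scaler_suml -big_split /=; apply: eq_bigr => i _.
    by rewrite Co po scalerDr.
  by rewrite big_ord_recr /= Cm pm E addrAC -scalerDl subrKC scale1r.
apply: convex_comb => // i _; rewrite /C /p.
by case: insubP => [j _ _|_]; split=> //; rewrite subr_ge0.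
Qed.

Lemma polyhedron_convex (k : nat) (P : set 'rV[R]_k) : polyhedron P -> is_convex P.
Proof.
move=> [p [q [r [A [b [C [d [E [f ->]]]]]]]]] t x y t01 [x1 x2 x3] [y1 y2 y3].
have trE : (t *: x + (1 - t) *: y)^T = t *: x^T + (1 - t) *: y^T.
  by rewrite linearD !linearZ.
split; rewrite trE mulmxDr -!scalemxAr.
- by rewrite x1 y1 -scalerDl subrKC scale1r.
- move=> i; rewrite !mxE; have := combination_le t01 (x2 i) (y2 i).
  by rewrite -mulrDl subrKC mul1r !mxE.
- move=> i; rewrite !mxE; have := combination_lt t01 (x3 i) (y3 i).
  by rewrite -mulrDl subrKC mul1r !mxE.
Qed.

(** The simplex spanned by x and the x + X_i is a polyhedron inside A; a right inverse of X yields
    its coordinates. *)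
Lemma simplex_dim (k m : nat) (A : set 'rV[R]_k) (x : 'rV[R]_k) (X : 'M[R]_(m, k)) :
  is_convex A -> row_free X -> A x -> (forall i, A (x + row i X)) ->
  (m <= polyhedral_dim A)%N.
Proof.
move=> Aconv Xfree Ax AX.
have [Y XY] : exists Y, X *m Y = 1%:M by exists (pinvmx X); exact: mulmxVp.
(* The equations put z - x in the row space of X; the inequalities say that the coordinates c = (z -
   x) Y are nonnegative with sum at most 1. The block of strict inequalities is empty. *)
pose P : set 'rV[R]_k := [set z |
  [/\ (1%:M - Y *m X)^T *m z^T = (1%:M - Y *m X)^T *m x^T,
      forall i, (col_mx (- Y^T) (const_mx 1 *m Y^T) *m z^T) i 0 <=
        (col_mx (- Y^T *m x^T) (const_mx 1 *m Y^T *m x^T + 1%:M : 'cV_1)) i 0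
    & forall i, ((0 : 'M[R]_(0, k)) *m z^T) i 0 < (0 : 'cV[R]_0) i 0]].
have Ppoly : polyhedron P by do 9 eexists.
have trN (u : 'rV[R]_m) i : (- u^T) i 0 = - u 0 i by rewrite !mxE.
have subE (u w : 'rV[R]_m) i : (u - w) 0 i = u 0 i - w 0 i by rewrite !mxE.
have sumE (u : 'rV[R]_m) : ((const_mx 1 : 'rV[R]_m) *m u^T) 0 0 = \sum_i u 0 i.
  by rewrite mxE; apply: eq_bigr => i _; rewrite !mxE mul1r.
have addE (u : 'cV[R]_1) : (u + 1%:M) 0 0 = u 0 0 + 1 by rewrite !mxE eqxx.
have PP z : P z <-> exists c : 'rV[R]_m,
    [/\ z = x + c *m X, forall i, 0 <= c 0 i & \sum_i c 0 i <= 1].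
  split=> [[z1 z2 _]|[c [-> c0 c1]]].
    exists ((z - x) *m Y); split.
    - move: z1; rewrite -!trmx_mul => /trmx_inj; rewrite !mulmxBr !mulmx1 => E.
      rewrite mulmxBl mulmxBl -!mulmxA.
      have -> : z *m (Y *m X) = z - (x - x *m (Y *m X)) by rewrite -E subKr.
      by rewrite -addrA [- _ - _]addrC addrA; apply/rowP => i; rewrite !mxE; lra.
    - move=> i; have := z2 (lshift _ i).
      by rewrite mul_col_mx !col_mxEu !mulNmx -!trmx_mul !trN lerN2 mulmxBl subE subr_ge0.
    - have := z2 (rshift _ 0).
      rewrite mul_col_mx !col_mxEd -!mulmxA -!trmx_mul sumE addE sumE => le.
      rewrite mulmxBl (eq_bigr (fun i => (z *m Y) 0 i - (x *m Y) 0 i)); last first.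
        by move=> i _; rewrite subE.
      by rewrite sumrB lerBlDl.
  have cXY : c *m X *m Y = c by rewrite -mulmxA XY mulmx1.
  split; last by case.
  - rewrite -!trmx_mul mulmxDl [c *m X *m _]mulmxBr mulmx1 [c *m X *m (_ *m _)]mulmxA.
    by rewrite cXY subrr addr0.
  - move=> i; case: (split_ordP i) => j ->.
      rewrite mul_col_mx !col_mxEu !mulNmx -!trmx_mul !trN lerN2 mulmxDl cXY.
      by rewrite [leRHS]mxE lerDl.
    rewrite mul_col_mx !col_mxEd -!mulmxA -!trmx_mul !ord1 sumE addE sumE mulmxDl cXY.
    rewrite (eq_bigr (fun i => (x *m Y) 0 i + c 0 i)); last by move=> l _; rewrite mxE.
    by rewrite big_split lerD2l.
have Px : P x.
  apply/PP; exists 0; rewrite mul0mx addr0; split=> // [i|]; first by rewrite mxE.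
  by rewrite big1 // => i _; rewrite mxE.
have PA : P `<=` A.
  move=> z /PP[c [-> c0 c1]]; rewrite mulmx_sum_row.
  exact: convex_simplex.
have mk : (m <= k)%N by rewrite -(eqP Xfree) rank_leq_col.
have le1 : (m <= affine_dim P)%N.
  pose i : 'I_k.+1 := Ordinal (mk : (m < k.+1)%N).
  rewrite /affine_dim; apply: (@leq_bigmax_cond _ _ (fun d : 'I_k.+1 => val d) i).
  apply/asboolP; exists x, X; split=> // j; apply/PP; exists (delta_mx 0 j); split.
  - by rewrite rowE.
  - by move=> l; rewrite mxE ler0n.
  - rewrite (bigD1 j) //= big1 ?mxE ?eqxx ?addr0 // => l lj.
    by rewrite mxE (negbTE lj) andbF.
apply: (leq_trans le1).
have adk : (affine_dim P < k.+1)%N.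
  by rewrite ltnS /affine_dim; apply/bigmax_leqP => i _; rewrite -ltnS.
apply: (@leq_bigmax_cond _ _ (fun d : 'I_k.+1 => val d) (Ordinal adk)).
by apply/asboolP; exists P; split=> //; exists x.
Qed.

End Convexity.

(** * Lower bound *)

Section Paths.
Variables (R : realType) (n : nat) (a : 'I_n.+1 -> int).
Implicit Types (v w : vertex n) (y z : 'rV[R]_n) (x : R) (f : nat -> R).

Local Notation A i := ((coef a i)%:~R : R).
Local Notation an := ((a ord_max)%:~R : R).

Lemma open_not_singleton (X : set R) (c : R) : open X -> X c ->
  exists2 x, X x & x != c.
Proof.
rewrite openE => /(_ c) /[apply] /nbhs_ballP[e /= e0 sub].
exists (c + e / 2); last by rewrite eq_sym -subr_eq0 opprD addNKr oppr_eq0; lra.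
apply: sub; rewrite /ball /= opprD addNKr normrN ger0_norm; lra.
Qed.

Lemma rigid_not_augmenting v w : rigid R a v w -> ~ augmenting R a v w.
Proof.
move=> [j [c H]] [y yv]; rewrite /= (H y yv) => -[oX _ _].
by have [x /= ->] := open_not_singleton oX erefl; rewrite eqxx.
Qed.

Lemma edge_flexible v w : edge R a v w -> augmenting R a v w -> flexible R a v w.
Proof. by move=> /edge_dichotomy[/rigid_not_augmenting|]. Qed.

Lemma edge_rigid v w : edge R a v w -> ~ augmenting R a v w -> rigid R a v w.
Proof.
move=> vw naug; have [//|flex] := edge_dichotomy vw; case: naug.
have [[_ _ _ [y yv] _] _ _ _] := vw.
by exists y => //; exact: flex.
Qed.

Lemma edge_continuation v w y : edge R a v w -> polyh a v y ->
  exists x, continuations a v w y x.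
Proof.
move=> /edge_dichotomy[[j [c H]]|H] yv; last by have [_ _ [x]] := H y yv; exists x.
by exists (y 0 j + c%:~R); rewrite (H y yv).
Qed.

Lemma augmenting_continuations v w y : edge R a v w -> augmenting R a v w ->
  polyh a v y -> exists x x',
    [/\ continuations a v w y x, continuations a v w y x' & x' != x].
Proof.
move=> vw aug /(edge_flexible vw aug)[oX _ [x xX]].
by have [x' x'X ne] := open_not_singleton oX xX; exists x, x'.
Qed.

Lemma polyh_convex v : is_convex (@polyh R n a v).
Proof.
move=> t y z t01 [y1 y2 y3 y4] [z1 z2 z3 z4].
have /andP[t0 t1] := t01.
have cst (c : R) : c = t * c + (1 - t) * c by lra.
split=> [j|r l rB lB rl e|r l rB lB rl e|j jB]; rewrite !mxE.
- exact: combination_le.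
- by rewrite (y2 r l) // (z2 r l) //; lra.
- have /andP[a1 a2] := y3 r l rB lB rl e; have /andP[b1 b2] := z3 r l rB lB rl e.
  have := combination_lt t01 a1 b1; have := combination_lt t01 a2 b2.
  by move=> *; apply/andP; split; lra.
- by have := combination_lt t01 (y4 j jB) (z4 j jB); lra.
Qed.

(** The set of all recurrent sequences is not convex in general, but the minimisers are constant on
    P_v: there the recurrence is one linear equation or one linear inequality. *)
Lemma satisfies_convex v y y' x x' (t : R) : vs v \in vB v -> 0 <= t <= 1 ->
  polyh a v y -> polyh a v y' ->
  satisfies a (extend y x) -> satisfies a (extend y' x') ->
  satisfies a (extend (t *: y + (1 - t) *: y') (t * x + (1 - t) * x')).
Proof.
move=> svB t01 yv yv' sat sat'.
have zv := polyh_convex t01 yv yv'.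
have [r rS] := argmin_exists a y (vs v).
have E := argmin_const svB yv zv; have E' := argmin_const svB yv yv'.
have [[u uE]|S2] := argmin_set1V2 a y (vs v).
- apply/(@satisfies1 _ _ _ _ _ u); first by rewrite -E.
  have /(_ x)[H _] := satisfies1 _ uE.
  have := uE; rewrite E' => uE'; have /(_ x')[H' _] := satisfies1 _ uE'.
  by rewrite (H sat) (H' sat') !mxE; ring.
- have E2 := S2; rewrite E' in E2; have E3 := S2; rewrite E in E3.
  have rS' := rS; rewrite E' in rS'; have rS3 := rS; rewrite E in rS3.
  apply/(satisfies2 _ E3 rS3); rewrite !mxE.
  by have := combination_le t01 (satisfies_ge rS sat) (satisfies_ge rS' sat'); lra.
Qed.

Definition window f (i : nat) : 'rV[R]_n := \row_(j < n) f (i + j)%N.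

(* Only the terms f 0, ..., f (L + n - 1) matter. *)
Definition follows (v : nat -> vertex n) (L : nat) f : Prop :=
  (forall i, (i <= L)%N -> polyh a (v i) (window f i)) /\
  (forall i, (i < L)%N -> satisfies a (extend (window f i) (f (i + n)%N))).

Lemma push_window f i : push (window f i) (f (i + n)%N) = window f i.+1.
Proof.
apply/rowP => j; have [jn|jn] := ord_lastVnext j.
  by rewrite (@push_next _ _ _ _ j (Ordinal jn)) // !mxE /= addSnnS.
by rewrite push_last // mxE addSnnS jn.
Qed.

Lemma eq_window f g i :
  (forall j, (j < i + n)%N -> f j = g j) -> window f i = window g i.
Proof. by move=> fg; apply/rowP => j; rewrite !mxE fg // ltn_add2l. Qed.

Lemma eq_follows (v : nat -> vertex n) L f g :
  (forall j, (j < L + n)%N -> f j = g j) -> follows v L f -> follows v L g.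
Proof.
move=> fg [H1 H2]; have sub i j : (i <= L)%N -> (j < i + n)%N -> f j = g j.
  by move=> iL ji; apply: fg; apply: leq_trans ji _; rewrite leq_add2r.
split=> i iL.
  by rewrite -(eq_window (sub i ^~ iL)); exact: H1.
rewrite -(eq_window (sub i ^~ (ltnW iL))) -fg ?ltn_add2r //; exact: H2.
Qed.

Lemma follows_extend (v : nat -> vertex n) L f x : follows v L f ->
  continuations a (v L) (v L.+1) (window f L) x ->
  follows v L.+1 (fun j => if (j == L + n)%N then x else f j).
Proof.
move=> fL [sat px].
set g := fun j => _.
have fg j : (j < L + n)%N -> f j = g j by move=> jL; rewrite /g ltn_eqF.
have gx : g (L + n)%N = x by rewrite /g eqxx.
have [H1 H2] := eq_follows fg fL.
have wE := eq_window fg.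
split=> i; rewrite ?ltnS leq_eqVlt => /orP[/eqP ->|].
- by rewrite -push_window gx -wE.
- by rewrite ltnS; exact: H1.
- by rewrite gx -wE.
- exact: H2.
Qed.

Lemma follows_convex (v : nat -> vertex n) L f g (t : R) : 0 <= t <= 1 ->
  (forall i, (i <= L)%N -> vs (v i) \in vB (v i)) ->
  follows v L f -> follows v L g ->
  follows v L (fun j => t * f j + (1 - t) * g j).
Proof.
move=> t01 vB [f1 f2] [g1 g2].
have wE i : window (fun j => t * f j + (1 - t) * g j) i =
    t *: window f i + (1 - t) *: window g i.
  by apply/rowP => j; rewrite !mxE.
split=> i iL; rewrite wE; first exact: polyh_convex t01 (f1 i iL) (g1 i iL).
have iL' := ltnW iL.
by apply: satisfies_convex t01 (f1 i iL') (g1 i iL') (f2 i iL) (g2 i iL); exact: vB.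
Qed.

(* Padded with zeros. *)
Definition seq_of_row (k : nat) (z : 'rV[R]_k) (j : nat) : R :=
  if insub j is Some i then z 0 i else 0.

Lemma seq_of_rowE k (z : 'rV[R]_k) (i : 'I_k) : seq_of_row z i = z 0 i.
Proof. by rewrite /seq_of_row valK. Qed.

Lemma extend_window f i (j : 'I_n.+1) :
  extend (window f i) (f (i + n)%N) 0 j = f (i + j)%N.
Proof.
case: (ord_maxVwiden j) => [->|[j' ->]]; rewrite ?extend_max //.
by rewrite extend_widen mxE.
Qed.

Lemma satisfies_windows L (z : 'rV[R]_(L + n)) : satisfies a z <->
  forall i, (i < L)%N ->
    satisfies a (extend (window (seq_of_row z) i) (seq_of_row z (i + n)%N)).
Proof.
split=> [sat i iL|H i w wE].
  have lt (j : 'I_n.+1) : (i + j < L + n)%N.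
    by rewrite -addSn leq_add // -ltnS.
  have := sat i (fun j => Ordinal (lt j)) (fun j => erefl).
  move=> [i1 [i2 [i12 le]]]; apply/satisfies_extend; exists i1, i2; split=> // j.
  by rewrite !extend_window; have := le j; rewrite -!seq_of_rowE.
have iL : (i < L)%N.
  by have := ltn_ord (w ord_max); rewrite wE /= ltn_add2r.
have /satisfies_extend[i1 [i2 [i12 le]]] := H i iL.
exists i1, i2; split=> // j; have := le j.
by rewrite !extend_window -!seq_of_rowE !wE.
Qed.

Definition num_aug (v : nat -> vertex n) (L : nat) : nat :=
  (\sum_(i < L) `[< augmenting R a (v i) (v i.+1) >])%N.

(** Induction on L, continuing all sequences along the next edge. At an augmenting edge [f] has two
    continuations; the second joins the family, and its difference with the first is zero except in
    the newest position, so independence is triangular. *)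
Lemma follows_independent (v : nat -> vertex n) :
  (forall i, edge R a (v i) (v i.+1)) -> forall L,
  exists (f : nat -> R) (F : nat -> nat -> R),
  [/\ follows v L f, forall i, (i < num_aug v L)%N -> follows v L (F i) &
    forall c : nat -> R,
      (forall j, (j < L + n)%N ->
        \sum_(i < num_aug v L) c i * (F i j - f j) = 0) ->
      forall i, (i < num_aug v L)%N -> c i = 0].
Proof.
move=> ve; elim=> [|L [f [F [fL FL ind]]]].
  have [[_ _ _ [y yv] _] _ _ _] := ve 0%N.
  exists (seq_of_row y), (fun _ => seq_of_row y).
  have wE : window (seq_of_row y) 0 = y.
    by apply/rowP => j; rewrite mxE add0n seq_of_rowE.
  have F0 : follows v 0 (seq_of_row y).
    by split=> i; rewrite ?leqn0 // => /eqP ->; rewrite wE.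
  by split=> // c _ i; rewrite /num_aug big_ord0.
have ext g : follows v L g -> exists x, continuations a (v L) (v L.+1) (window g L) x.
  by move=> [gL _]; apply: edge_continuation (ve L) (gL L (leqnn L)).
have /boolp.choice[G HG] : forall i, exists x, (i < num_aug v L)%N ->
    continuations a (v L) (v L.+1) (window (F i) L) x.
  by move=> i; case: (ltnP i (num_aug v L)) => [/FL/ext[x xc]|_]; [exists x|exists 0].
pose up g x (j : nat) : R := if (j == L + n)%N then x else g j.
have upE g x j : (j < L + n)%N -> up g x j = g j by move=> jL; rewrite /up ltn_eqF.
have upL g x : up g x (L + n)%N = x by rewrite /up eqxx.
have low (j : nat) : (j < L + n)%N -> (j < L.+1 + n)%N.
  by move=> /leq_trans; apply; rewrite addSn.
have SE : num_aug v L.+1 = (num_aug v L + `[< augmenting R a (v L) (v L.+1) >])%N.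
  by rewrite /num_aug big_ord_recr.
case: (pselect (augmenting R a (v L) (v L.+1))) => [aug|naug]; last first.
  have [x xc] := ext f fL.
  rewrite SE asboolF // addn0.
  exists (up f x), (fun i => up (F i) (G i)); split.
  - exact: follows_extend.
  - by move=> i iL; apply: follows_extend (FL i iL) (HG i iL).
  - move=> c H; apply: ind => j jL; rewrite -[RHS](H j (low _ jL)).
    by apply: eq_bigr => i _; rewrite !upE.
have [x [x' [xc x'c ne]]] := augmenting_continuations (ve L) aug (fL.1 L (leqnn L)).
rewrite SE asboolT // addn1.
set m := num_aug v L in FL ind HG *.
exists (up f x), (fun i => if (i == m)%N then up f x' else up (F i) (G i)); split.
- exact: follows_extend.
- move=> i; rewrite ltnS leq_eqVlt; case: eqP => [_ _|_ /= iL].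
    exact: follows_extend.
  exact: follows_extend (FL i iL) (HG i iL).
- move=> c H.
  (* The new member agrees with [f] on the old positions, so these kill the old coefficients; the
     newest position then leaves [c m * (x' - x) = 0]. *)
  have c0 i : (i < m)%N -> c i = 0.
    move=> im; apply: ind im => j jL; have := H j (low _ jL).
    rewrite big_ord_recr /= eqxx !upE // subrr mulr0 addr0 => E.
    rewrite -[RHS]E; apply: eq_bigr => l _.
    by rewrite ltn_eqF // !upE.
  have := H (L + n)%N; rewrite addSn ltnSn => /(_ isT).
  rewrite big_ord_recr /= big1 => [|l _]; last by rewrite c0 // mul0r.
  rewrite eqxx !upL add0r => /eqP; rewrite mulf_eq0 subr_eq0 (negbTE ne) orbF => /eqP cm.
  by move=> i; rewrite ltnS leq_eqVlt => /orP[/eqP ->|/c0].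
Qed.

Lemma num_aug_le_hilbert (v : nat -> vertex n) (L : nat) :
  (forall i, edge R a (v i) (v i.+1)) ->
  (num_aug v L <= trop_hilbert R a (L + n))%N.
Proof.
move=> ve; have [f [F [fL FL ind]]] := follows_independent ve L.
set m := num_aug v L in FL ind *.
pose Q : set 'rV[R]_(L + n) := [set z | follows v L (seq_of_row z)].
have vv i : vs (v i) \in vB (v i) by have [[]] := ve i.
have Qconv : is_convex Q.
  move=> t y z t01 yQ zQ; apply: eq_follows (follows_convex t01 (fun i _ => vv i) yQ zQ).
  by move=> j jL; rewrite -[j]/(val (Ordinal jL)) !seq_of_rowE !mxE.
have QD : Q `<=` @trop_rec_seqs R n a (L + n).
  by move=> z [_ H]; apply/satisfies_windows.
pose row_of g : 'rV[R]_(L + n) := \row_j g (val j).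
have rowQ g : follows v L g -> Q (row_of g).
  apply: eq_follows => j jL.
  by rewrite -[j in RHS]/(val (Ordinal jL)) seq_of_rowE mxE.
pose X : 'M[R]_(m, L + n) := \matrix_(i, j) (F i j - f j).
have Xfree : row_free X.
  apply: inj_row_free => u uX; apply/rowP => i; rewrite [RHS]mxE -seq_of_rowE.
  apply: ind (ltn_ord i) => j jL.
  have /rowP/(_ (Ordinal jL)) := uX; rewrite !mxE => E; rewrite -[RHS]E.
  by apply: eq_bigr => l _; rewrite seq_of_rowE !mxE.
have mQ : (m <= polyhedral_dim Q)%N.
  apply: (@simplex_dim _ _ _ _ (row_of f) X) => //; first exact: rowQ.
  move=> i; have -> : row_of f + row i X = row_of (F i).
    by apply/rowP => j; rewrite !mxE subrKC.
  exact/rowQ/FL.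
apply: (leq_trans mQ); apply/bigmax_leqP => d /asboolP[P [P1 P2 P3 P4]].
apply: (@leq_bigmax_cond _ _ (fun d : 'I_(L + n).+1 => val d) d).
by apply/asboolP; exists P; split=> //; exact: subset_trans P3 QD.
Qed.

End Paths.

(** * Upper bound *)

(** Following the copies back to earlier columns ends in [S], so X factors through its columns
    indexed by [S]. *)
Lemma rank_le_columns (F : fieldType) (m N : nat) (X : 'M[F]_(m, N)) (S : {set 'I_N}) :
  row_free X ->
  (forall j, j \notin S -> exists2 j' : 'I_N, (j' < j)%N & forall i, X i j = X i j') ->
  (m <= #|S|)%N.
Proof.
move=> Xfree H.
have rep (j : 'I_N) : exists k : 'I_#|S|, forall i, X i j = X i (enum_val k).
  move: {2}(val j).+1 (ltnSn j) => b; elim: b j => // b IH j jb.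
  have [jS|jS] := boolP (j \in S).
    by exists (enum_rank_in jS j) => i; rewrite enum_rankK_in.
  have [j' j'j E] := H j jS.
  have [|k Ek] := IH j'; first by apply: leq_trans j'j _; rewrite -ltnS.
  by exists k => i; rewrite E.
have /boolp.choice[g gE] := rep.
have -> : m = \rank X by rewrite (eqP Xfree).
have -> : X = (\matrix_(i, k) X i (enum_val k)) *m (\matrix_(k, j) (k == g j)%:R).
  apply/matrixP => i j; rewrite !mxE (bigD1 (g j)) //= big1 => [|k kg].
    by rewrite !mxE eqxx mulr1 addr0.
  by rewrite !mxE (negbTE kg) mulr0.
exact: leq_trans (mxrankM_maxl _ _) (rank_leq_col _).
Qed.

Lemma pigeonhole_fiber (T : finType) (g : nat -> T) (N : nat) :
  exists t (s : seq nat), [/\ uniq s, (N < size s)%N & forall i, i \in s -> g i = t].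
Proof.
pose m := (#|T| * N).+1.
pose fib t : {set 'I_m} := [set i : 'I_m | g i == t]%SET.
have [t tN] : exists t, (N < #|fib t|)%N.
  apply/existsP; apply: contraT; rewrite negb_exists => /forallP H.
  have : (#|'I_m| <= #|T| * N)%N; last by rewrite card_ord ltnn.
  rewrite -sum1_card (partition_big (fun i : 'I_m => g i) predT) //=.
  rewrite -sum_nat_const; apply: leq_sum => t _.
  have := H t; rewrite -leqNgt; apply: leq_trans.
  by rewrite -sum1_card; apply/eq_leq/eq_bigl => i; rewrite finset.inE.
exists t, [seq val i | i <- enum (fib t)]; split.
- by rewrite (map_inj_uniq val_inj) enum_uniq.
- by rewrite size_map -cardE.
- by move=> i /mapP[j + ->]; rewrite mem_enum finset.inE => /eqP.
Qed.

(** The expression is a polynomial in t of degree at most m with more than m roots, and D_i is its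
    coefficient of degree i + 1. *)
Lemma polynomial_zero (F : fieldType) (m : nat) (d : F) (D : 'I_m -> F) (s : seq F) :
  uniq s -> (m < size s)%N ->
  (forall t, t \in s -> d + \sum_i D i * t ^+ i.+1 = 0) -> forall i, D i = 0.
Proof.
move=> us ms H i.
pose q : {poly F} := d%:P + \sum_(i < m) D i *: 'X^(i.+1).
have q0 : q = 0.
  apply/eqP; apply: contraT => qn0.
  have : (size s < size q)%N.
    apply: max_poly_roots => //; apply/allP => t /H tE.
    rewrite /root /q hornerD hornerC horner_sum -[X in _ == X]tE.
    apply/eqP; congr (_ + _).
    by apply: eq_bigr => j _; rewrite hornerZ hornerXn.
  suff : (size q <= m.+1)%N by lia.
  apply: (leq_trans (size_polyD _ _)); rewrite geq_max.
  rewrite (leq_trans (size_polyC_leq1 _)) //=.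
  apply: (leq_trans (size_sum _ _ _)); apply/bigmax_leqP => j _.
  by apply: (leq_trans (size_scale_leq _ _)); rewrite size_polyXn ltnS.
have : q`_i.+1 = 0 by rewrite q0 coef0.
rewrite coefD coefC /= add0r coef_sum (bigD1 i) //= big1 => [|j ji].
  by rewrite addr0 coefZ coefXn eqxx mulr1.
by rewrite coefZ coefXn eqSS eq_sym (inj_eq val_inj) (negbTE ji) mulr0.
Qed.

Section UpperBound.
Variables (R : realType) (n : nat) (a : 'I_n.+1 -> int).
Implicit Types (f : nat -> R).

Definition vm_bound : nat := absz (2 * n%:Z * spread a).

(* The entries of vm range over [-vm_bound, vm_bound]; they are shifted to
   [0, 2 vm_bound]. *)
Definition vertex_codes : finType :=
  ({set 'I_n} * 'I_n * 'M['I_(vm_bound.*2.+1)]_n * 'M[bool]_n)%type.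

Definition vertex_of_code (c : vertex_codes) : vertex n :=
  let: (B, s, m, e) := c in
  Vertex B s (map_mx (fun k : 'I_(vm_bound.*2.+1) => k%:Z - vm_bound%:Z) m) e.

Lemma is_vertex_code v : is_vertex R a v -> exists c, v = vertex_of_code c.
Proof.
move=> [_ [_ _ bnd] zero _ _].
have bndE : vm_bound%:Z = 2 * n%:Z * spread a.
  by rewrite /vm_bound abszE ger0_norm // !mulr_ge0 // spread_ge0.
have lt r l : (absz (vm v r l + vm_bound%:Z)%R < vm_bound.*2.+1)%N.
  have : `|vm v r l| <= vm_bound%:Z.
    have [/and3P[rB lB rl]|/zero[-> _]] := boolP [&& r \in vB v, l \in vB v & (r < l)%N].
      by rewrite bndE; exact: bnd.
    by rewrite normr0.
  by lia.
exists (vB v, vs v, \matrix_(r, l) Ordinal (lt r l), ve v).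
case: v bnd zero lt => B s m e /= bnd zero lt; congr Vertex.
apply/matrixP => r l; rewrite !mxE /=.
have : `|m r l| <= vm_bound%:Z.
  have [/and3P[rB lB rl]|/zero[-> _]] := boolP [&& r \in B, l \in B & (r < l)%N].
    by rewrite bndE; exact: bnd.
  by rewrite normr0.
by lia.
Qed.

Lemma satisfies_path (hn : (0 < n)%N) (L : nat) f :
  (forall i, (i < L)%N -> satisfies a (extend (window n f i) (f (i + n)%N))) ->
  exists v : nat -> vertex n, [/\ is_vertex R a (v 0%N), follows a v L f
    & forall i, (i < L)%N -> edge R a (v i) (v i.+1)].
Proof.
elim: L => [|L IH] sat.
  have [v vV vf] := exists_vertex a hn (window n f 0).
  by exists (fun _ => v); split=> //; split=> // i; rewrite leqn0 => /eqP ->.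
have [|v [v0 [fL satL] ve]] := IH; first by move=> i iL; apply: sat; exact: ltnW.
have vV : is_vertex R a (v L).
  by case: (L) ve => [//|L'] /(_ L' (ltnSn L'))[].
have [w vw wP] := satisfies_edge vV (fL L (leqnn L)) (sat L (ltnSn L)).
pose v' i := if (i <= L)%N then v i else w.
have vE i : (i <= L)%N -> v' i = v i by rewrite /v' => ->.
have v'S : v' L.+1 = w by rewrite /v' ltnn.
exists v'; split; first by rewrite vE.
  split=> // i; rewrite leq_eqVlt => /orP[/eqP ->|]; last first.
    by rewrite ltnS => iL; rewrite vE //; exact: fL.
  by rewrite v'S -push_window.
move=> i; rewrite ltnS leq_eqVlt => /orP[/eqP ->|iL].
  by rewrite v'S vE.
by rewrite !vE //; [exact: ve | exact: ltnW].
Qed.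

Lemma hilbert_le (hn : (0 < n)%N) (L K : nat) :
  (forall v : nat -> vertex n, is_vertex R a (v 0%N) ->
     (forall i, (i < L)%N -> edge R a (v i) (v i.+1)) -> (num_aug R a v L <= K)%N) ->
  (trop_hilbert R a (L + n) <= n + K)%N.
Proof.
move=> HK; apply/bigmax_leqP => _ /asboolP[P [Ppoly _ PD <-]].
apply/bigmax_leqP => d /asboolP[x [X [Px Xfree PX]]].
set e := nat_of_ord d in X Xfree PX *.
(* Points of the curve t |-> x + \sum_i t ^ (i + 1) X_i with t <= 1/e lie in the
   simplex spanned by x and the x + X_i. *)
pose tau (m : nat) : R := (m + e.+1)%:R^-1.
have tau0 m : 0 < tau m by rewrite invr_gt0 ltr0n addnS.
have tau1 m : tau m <= 1 by rewrite invf_le1 ?ler1n ?ltr0n addnS.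
have tau_inj : injective tau.
  by move=> m m' /invr_inj/eqP; rewrite eqr_nat eqn_add2r => /eqP.
pose p m := x + \sum_(i < e) tau m ^+ i.+1 *: row i X.
have pP m : P (p m).
  apply: convex_simplex => //; first exact: polyhedron_convex.
    by move=> i; rewrite exprn_ge0 // ltW.
  apply: (@le_trans _ _ (\sum_(i < e) tau m)).
    by apply: ler_sum => i _; rewrite exprS ler_piMr ?exprn_ile1 // ltW.
  rewrite sumr_const card_ord -[X in X <= _]mulr_natl ler_pdivrMr ?ltr0n ?addnS // mul1r.
  by rewrite ler_nat ltnW // ltnS leq_addl.
(* Paths are recorded as elements of a finite type, so that the pigeonhole principle yields more
   than e points following one path. *)
have paths m : exists c : {ffun 'I_L.+1 -> vertex_codes},
    let v i := vertex_of_code (c (inord i)) in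
    [/\ is_vertex R a (v 0%N), follows a v L (seq_of_row (p m))
      & forall i, (i < L)%N -> edge R a (v i) (v i.+1)].
  have /satisfies_windows/(satisfies_path hn)[v [v0 [vf1 vf2] ve]] := PD _ (pP m).
  have vV i : (i <= L)%N -> is_vertex R a (v i).
    by case: i => [//|i] /ve[].
  have /boolp.choice[c cE] : forall i : 'I_L.+1, exists c, v i = vertex_of_code c.
    by move=> i; apply/is_vertex_code/vV; rewrite -ltnS.
  exists (finfun c) => /=.
  have E i : (i <= L)%N -> vertex_of_code ([ffun i => c i] (inord i)) = v i.
    by move=> iL; rewrite ffunE -cE inordK.
  split; first by rewrite E.
    by split=> // i iL; rewrite E //; exact: vf1.
  by move=> i iL; rewrite !E //; [exact: ve | exact: ltnW].
have /boolp.choice[g gP] := paths.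
have [c [s [us es gs]]] := pigeonhole_fiber g e.
pose v i := vertex_of_code (c (inord i)).
have vP m : m \in s -> [/\ is_vertex R a (v 0%N), follows a v L (seq_of_row (p m))
      & forall i, (i < L)%N -> edge R a (v i) (v i.+1)].
  by move=> ms; have := gP m; rewrite gs.
have [v0 ve] : is_vertex R a (v 0%N) /\ forall i, (i < L)%N -> edge R a (v i) (v i.+1).
  case: s es {us gs} vP => // m s _ /(_ m (mem_head _ _)) [v0 _ ve].
  by split.
(* Free columns: the n initial coordinates and, for each augmenting edge i, the coordinate i + n
   that it creates. *)
pose S : {set 'I_(L + n)} := [set j : 'I_(L + n) | (j < n)%N ||
  `[< augmenting R a (v (j - n)%N) (v (j - n).+1) >]]%SET.
have cS : (#|S| <= n + K)%N.
  apply: leq_trans (leq_add (leqnn n) (HK v v0 ve)).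
  rewrite -sum1_card (eq_bigl (fun j : 'I_(L + n) => (j < n)%N ||
    `[< augmenting R a (v (j - n)%N) (v (j - n).+1) >])); last first.
    by move=> j; rewrite finset.inE.
  rewrite big_mkcond /= -(big_mkord xpredT (fun j => if (j < n)%N ||
    `[< augmenting R a (v (j - n)%N) (v (j - n).+1) >] then 1%N else 0%N)).
  rewrite (@big_cat_nat _ _ _ n) ?leq_addl //=; apply: leq_add.
    rewrite big_nat (eq_bigr (fun _ => 1%N)) => [|j /andP[_ ->] //].
    by rewrite -big_nat sum_nat_const_nat subn0 muln1.
  rewrite -{1}[n]add0n big_addn addnK big_mkord /num_aug; apply: leq_sum => i _.
  by rewrite addnK ltnNge leq_addl /=; case: `[< _ >].
apply: leq_trans cS; apply: rank_le_columns Xfree _ => j.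
rewrite finset.inE negb_or -leqNgt => /andP[nj /asboolPn naug].
have iL : (j - n < L)%N by rewrite -(ltn_add2r n) subnK.
set i := (j - n)%N in iL naug.
have jE : j = (i + n)%N :> nat by rewrite subnK.
have [r [c0 rc]] := edge_rigid (ve i iL) naug.
have j'L : (i + r < L + n)%N by rewrite -addSn leq_add // ltnW.
pose j' := Ordinal j'L.
have j'j : (j' < j)%N by rewrite jE /= ltn_add2l.
exists j' => // l.
(* Rigidity makes coordinate j equal to coordinate j' plus [c0] at more than e points of the curve;
   as a polynomial identity in [tau], this forces columns j and j' of X to agree. *)
apply/eqP; rewrite -subr_eq0; apply/eqP.
apply: (@polynomial_zero _ _ (x 0 j - x 0 j' - c0%:~R)
  (fun l => X l j - X l j') [seq tau m | m <- s]).
- by rewrite map_inj_uniq.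
- by rewrite size_map.
move=> _ /mapP[m ms ->].
have [_ [f1 f2] _] := vP m ms.
have cont : continuations a (v i) (v i.+1) (window n (seq_of_row (p m)) i)
    (seq_of_row (p m) (i + n)%N).
  by split; [exact: f2 | rewrite push_window; exact: f1].
have := rc _ (f1 i (ltnW iL)) => E; rewrite E /= mxE in cont.
move: cont; rewrite -jE -[(i + r)%N]/(val j') !seq_of_rowE.
rewrite /p !mxE !summxE => H.
rewrite (eq_bigr (fun k : 'I_e =>
  (tau m ^+ k.+1 *: row k X) 0 j - (tau m ^+ k.+1 *: row k X) 0 j')).
  by rewrite sumrB; lra.
by move=> k _; rewrite !mxE; ring.
Qed.

End UpperBound.

(** * Paths and cycles *)

(** If the tail already has a repetition, its loop serves; otherwise x recurs in p, and the segment
    up to that recurrence is a loop without further repetitions. *)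
Lemma uniq_loop (T : eqType) (x : T) (p : seq T) : ~~ uniq (x :: p) ->
  exists p1 c y p2, [/\ p = p1 ++ rcons c y ++ p2, last x p1 = y & uniq (y :: c)].
Proof.
elim: p x => [//|z p IH] x.
have [uzp|/IH[p1 [c [y [p2 [-> <- yc]]]]] _] := boolP (uniq (z :: p)); last first.
  by exists (z :: p1), c, (last z p1), p2.
rewrite [uniq (x :: _)]/= -/(uniq (z :: p)) uzp andbT negbK => xp.
case/splitPr: xp uzp => p1 p2; rewrite cat_uniq /= negb_or => /and3P[u1 /andP[xp1 _] _].
by exists [::], p1, x, p2; rewrite /= xp1 cat_rcons.
Qed.

Section PathWeight.
Variables (R : realType) (n : nat) (a : 'I_n.+1 -> int).
Implicit Types (x : vertex n) (p T : seq (vertex n)).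

Local Notation edgeb := (fun v w => `[< edge R a v w >]).
Local Notation augb v w := (nat_of_bool `[< augmenting R a v w >]).

Fixpoint path_aug x p : nat :=
  if p is y :: p' then (augb x y + path_aug y p')%N else 0%N.

Lemma path_aug_cat x p1 p2 :
  path_aug x (p1 ++ p2) = (path_aug x p1 + path_aug (last x p1) p2)%N.
Proof. by elim: p1 x => //= y p1 IH x; rewrite IH addnA. Qed.

Lemma path_aug_le x p : (path_aug x p <= size p)%N.
Proof. by elim: p x => //= y p IH x; rewrite -add1n leq_add // leq_b1. Qed.

Lemma path_augE x p :
  path_aug x p = (\sum_(i < size p) augb (nth x (x :: p) i) (nth x p i))%N.
Proof.
elim: p x => [|y p IH] x; first by rewrite big_ord0.
rewrite /= big_ord_recl IH /=; congr (_ + _)%N.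
apply: eq_bigr => i _; have iy : (i < size (y :: p))%N by rewrite ltnS ltnW.
by rewrite (set_nth_default x y iy) (set_nth_default x y (ltn_ord i)).
Qed.

Lemma num_aug_path (v : nat -> vertex n) L :
  num_aug R a v L = path_aug (v 0%N) (mkseq (fun i => v i.+1) L).
Proof.
rewrite path_augE size_mkseq; apply: eq_bigr => -[i iL] _ /=.
rewrite nth_mkseq //; case: i iL => [//|i iL] /=.
by rewrite nth_mkseq // ltnW.
Qed.

Lemma num_augmenting_path x p : uniq (x :: p) ->
  num_augmenting R a (x :: p) = path_aug x (rcons p x).
Proof.
move=> up; rewrite /num_augmenting -sum1_count big_mkcond (big_nth x) big_mkord.
rewrite path_augE size_rcons; apply: eq_bigr => i _.
rewrite next_nth mem_nth // index_uniq //.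
have -> : nth x (x :: rcons p x) i = nth x (x :: p) i.
  by case: i => -[|i] //= ip; rewrite nth_rcons -ltnS ip.
have -> : nth x (rcons p x) i = nth x p i.
  by rewrite nth_rcons; case: ltngtP => // le; rewrite nth_default // ?le // ltnW.
by case: `[< _ >].
Qed.

Lemma path_loop x p : path edgeb x p -> ~~ uniq (x :: p) ->
  exists p1 T p2, [/\ path edgeb x (p1 ++ p2), simple_cycle R a T,
    {subset p1 ++ p2 <= p}, size p = (size (p1 ++ p2) + size T)%N
    & path_aug x p = (path_aug x (p1 ++ p2) + num_augmenting R a T)%N].
Proof.
move=> ep /uniq_loop[p1 [c [y [p2 [pE p1y uc]]]]].
exists p1, (y :: c), p2; move: ep; rewrite {}pE !cat_path last_rcons p1y.
move=> /and3P[e1 ec e2]; split; first by rewrite e1.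
- by rewrite /simple_cycle /ucycle /= ec.
- by move=> z; rewrite !mem_cat => /orP[->|->]; rewrite ?orbT.
- by rewrite !size_cat size_rcons /= addnCA addnC.
- by rewrite !path_aug_cat last_rcons p1y num_augmenting_path // addnAC addnA.
Qed.

(** Strong induction on the length: at a repetition a simple cycle is cut out, to which the
    hypothesis applies; a walk without repetition has fewer than [size V] edges. Ratios are compared
    by cross-multiplication. *)
Lemma path_aug_bound (V : seq (vertex n)) (A l : nat) :
  (forall T, simple_cycle R a T -> (num_augmenting R a T * l <= A * size T)%N) ->
  forall x p, path edgeb x p -> {subset x :: p <= V} ->
  (path_aug x p * l <= A * size p + size V * l)%N.
Proof.
move=> Hcyc x p; move: {2}(size p).+1 (ltnSn (size p)) => b.
elim: b p => // b IH p pb ep pV.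
have [up|nup] := boolP (uniq (x :: p)).
  apply: leq_trans (leq_addl _ _); rewrite leq_mul2r; apply/orP; right.
  apply: leq_trans (path_aug_le _ _) _; apply: leq_trans (leqnSn _) _.
  exact: uniq_leq_size up pV.
have [p1 [T [p2 [e12 Tc sub sE wE]]]] := path_loop ep nup.
have T0 : (0 < size T)%N by case: (T) Tc.1.
have := Hcyc T Tc; have := IH (p1 ++ p2); rewrite sE wE.
have lt : (size (p1 ++ p2) < b)%N by move: pb; rewrite sE; clear -T0; lia.
move=> /(_ lt e12); have sub' : {subset x :: p1 ++ p2 <= V}.
  move=> z; rewrite inE => /predU1P[->|/sub zp]; apply: pV; first exact: mem_head.
  by rewrite inE zp orbT.
by move=> /(_ sub'); clear; lia.
Qed.

Lemma simple_cycle_vertex T v : simple_cycle R a T -> v \in T -> is_vertex R a v.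
Proof. by move=> [_ /andP[Tc _]] vT; have /asboolP[] := next_cycle Tc vT. Qed.

(** The walk goes round the cycle forever; each complete turn collects all its augmenting edges, and
    the incomplete last turn is discarded. *)
Lemma cycle_walk T : simple_cycle R a T -> exists v : nat -> vertex n,
  (forall i, edge R a (v i) (v i.+1)) /\
  forall L, ((L %/ size T) * num_augmenting R a T <= num_aug R a v L)%N.
Proof.
move=> Tc; have [T0 /andP[Tcyc uT]] := Tc.
case: T => // x c in Tc T0 Tcyc uT *.
set T := x :: c in Tc T0 Tcyc uT *.
pose v i := iter i (next T) x.
have vT i : v i \in T.
  by elim: i => [|i IH]; [exact: mem_head | rewrite /v iterS mem_next].
exists v; split=> [i|L]; first by have /asboolP := next_cycle Tcyc (vT i).
have trE : rcons c x = mkseq (fun i => v i.+1) (size T).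
  have /fpathE -> : fpath (next T) x (rcons c x) := cycle_next uT.
  rewrite size_rcons; apply: (@eq_from_nth _ (next T x)).
    by rewrite size_traject size_mkseq.
  move=> i; rewrite size_traject => ic.
  by rewrite nth_traject // nth_mkseq // /v iterSr.
have per i : v (size T + i)%N = v i.
  have vl : v (size T) = x.
    by rewrite -[RHS](last_rcons x c x) trE -nth_last size_mkseq nth_mkseq.
  by rewrite /v addnC iterD -/(v (size T)) vl.
have one : num_aug R a v (size T) = num_augmenting R a T.
  by rewrite num_aug_path -trE -num_augmenting_path.
have split_aug L1 L2 : num_aug R a v (L1 + L2) =
    (num_aug R a v L1 + num_aug R a (fun i => v (L1 + i)%N) L2)%N.
  rewrite /num_aug big_split_ord /=; congr (_ + _)%N.
  by apply: eq_bigr => i _; rewrite addnS.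
have mult q : num_aug R a v (q * size T) = (q * num_augmenting R a T)%N.
  elim: q => [|q IH]; first by rewrite !mul0n /num_aug big_ord0.
  rewrite !mulSn split_aug one; congr (_ + _)%N; rewrite -IH.
  by apply: eq_bigr => i _; cbv beta; rewrite !per.
by rewrite {2}(divn_eq L (size T)) split_aug mult leq_addr.
Qed.

(** * Finiteness of the graph and a cycle of maximal ratio *)

Lemma vertex_list : exists V : seq (vertex n), forall v, is_vertex R a v -> v \in V.
Proof.
exists [seq vertex_of_code c | c <- enum (vertex_codes a)] => v /is_vertex_code[c ->].
by apply: map_f; rewrite mem_enum.
Qed.

(** Every point of P_v has a continuation: placing the new term level with the minimum always
    satisfies the recurrence. *)
Lemma edge_successor v : is_vertex R a v -> exists w, edge R a v w.
Proof.
move=> vV; have [svB _ _ [y yv] _] := vV.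
have [t tS] := argmin_exists a y (vs v).
suff [x sat] : exists x : R, satisfies a (extend y x).
  by have [w vw _] := satisfies_edge vV yv sat; exists w.
exists (y 0 t + (coef a t)%:~R - (a ord_max)%:~R).
have [[u uE]|S2] := argmin_set1V2 a y (vs v).
- by apply/(satisfies1 _ uE); move: tS; rewrite uE finset.in_set1 => /eqP ->.
- by apply/(satisfies2 _ S2 tS); rewrite subrK.
Qed.

(** Iterating a choice of successors inside a finite vertex set must repeat a vertex. *)
Lemma simple_cycle_exists : (0 < n)%N -> exists T, simple_cycle R a T.
Proof.
move=> hn; have [v0 v0V _] := exists_vertex a hn (0 : 'rV[R]_n).
have /boolp.choice[g gE] : forall v, exists w, is_vertex R a v -> edge R a v w.
  move=> v; have [/edge_successor[w]|nv] := pselect (is_vertex R a v).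
    by exists w.
  by exists v.
have [V VE] := vertex_list.
have iterV i : is_vertex R a (iter i g v0).
  by elim: i => //= i /gE[].
have ep m i : path edgeb (iter i g v0) (traject g (iter i.+1 g v0) m).
  elim: m i => // m IH i; apply/andP; split; last exact: (IH i.+1).
  exact/asboolP/gE.
have nu : ~~ uniq (v0 :: traject g (g v0) (size V)).
  rewrite -[_ :: _]/(traject g v0 (size V).+1); apply/negP => /uniq_leq_size H.
  suff : ((size V).+1 <= size V)%N by rewrite ltnn.
  rewrite -[X in (X <= _)%N](size_traject g v0); apply: H => z /trajectP[i _ ->].
  exact: VE.
by have [p1 [T [p2 [_ Tc _ _ _]]]] := path_loop (ep (size V) 0%N) nu; exists T.
Qed.

Lemma cycle_ratioE T : simple_cycle R a T -> forall A l : nat, (0 < l)%N ->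
  (cycle_ratio R a T <= A%:R / l%:R) = (num_augmenting R a T * l <= A * size T)%N.
Proof.
move=> [T0 _] A l l0; rewrite /cycle_ratio.
have sT : (0 < size T)%N by case: (T) T0.
rewrite ler_pdivrMr ?ltr0n // mulrAC ler_pdivlMr ?ltr0n //.
by rewrite -!natrM ler_nat.
Qed.

(** A simple cycle has at most [size V] vertices, so only finitely many pairs of number of
    augmenting edges and length occur; the maximum is taken over these pairs. *)
Lemma max_cycle : (0 < n)%N -> exists2 T, simple_cycle R a T &
  forall T', simple_cycle R a T' -> cycle_ratio R a T' <= cycle_ratio R a T.
Proof.
move=> hn; have [V VE] := vertex_list; have [T0 T0c] := simple_cycle_exists hn.
pose N := (size V).+1.
have sT T : simple_cycle R a T -> (size T < N)%N.
  move=> Tc; rewrite ltnS; have [_ /andP[_ uT]] := Tc.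
  by apply: uniq_leq_size uT _ => v /(simple_cycle_vertex Tc)/VE.
have nT T : simple_cycle R a T -> (num_augmenting R a T < N)%N.
  by move=> /sT; apply: leq_ltn_trans; exact: count_size.
pose P (c : 'I_N * 'I_N) := `[< exists2 T, simple_cycle R a T &
  num_augmenting R a T = c.1 /\ size T = c.2 >].
have code T : simple_cycle R a T -> exists2 c, P c &
    cycle_ratio R a T = c.1%:R / c.2%:R.
  move=> Tc; exists (Ordinal (nT T Tc), Ordinal (sT T Tc)) => //.
  by apply/asboolP; exists T.
have [c0 Pc0 _] := code T0 T0c.
pose cm := [arg max_(c > c0 | P c) (c.1%:R / c.2%:R : R)]%O.
have [/asboolP[T Tc [n1 n2]] cmax] : P cm /\ forall c, P c ->
    c.1%:R / c.2%:R <= cm.1%:R / cm.2%:R :> R.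
  by rewrite /cm; case: Order.TotalTheory.arg_maxP.
exists T => // T' /code[c Pc ->].
by rewrite /cycle_ratio n1 n2; exact: cmax.
Qed.

End PathWeight.

(** * The limit: both bounds differ from H k by a constant *)

Theorem corollary0p2 (R : realType) (n : nat) (a : 'I_n.+1 -> int)
    (hn : (1 <= n)%N) :
  [/\ cvgn (trop_hilbert_ratio R a),
      exists2 T : seq (vertex n), simple_cycle R a T &
        trop_entropy R a = cycle_ratio R a T,
      forall T : seq (vertex n), simple_cycle R a T ->
        cycle_ratio R a T <= trop_entropy R a
    & exists q : rat, trop_entropy R a = ratr q].
Proof.
have [T Tc Tmax] := max_cycle R a hn.
have [V VE] := vertex_list R a.
set H := cycle_ratio R a T in Tmax *.
pose A := num_augmenting R a T; pose l := size T.
have l0 : (0 < l)%N by rewrite lt0n size_eq0; case: Tc.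
have lR : (0 : R) < l%:R by rewrite ltr0n.
have HE : H = A%:R / l%:R by [].
have H0 : 0 <= H by rewrite HE divr_ge0.
(* One constant for both bounds: n + size V is the loss in the upper bound, A + H n that in the
   lower one. *)
pose C : R := (n + size V + A)%:R + H * n%:R.
have C0 : 0 <= C by rewrite addr_ge0 // mulr_ge0.
have upper L : (trop_hilbert R a (L + n))%:R <= H * (L + n)%:R + C.
  have le : (trop_hilbert R a (L + n) <= n + (A * L + size V * l) %/ l)%N.
    apply: hilbert_le => // v v0 ve; rewrite leq_divRL // num_aug_path.
    rewrite -[X in (A * X)%N](size_mkseq (fun i => v i.+1)).
    apply: (@path_aug_bound R n a).
    - by move=> T' T'c; rewrite -(cycle_ratioE T'c) // -HE; exact: Tmax.
    - apply/(pathP (v 0%N)) => i; rewrite size_mkseq => iL.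
      apply/asboolP; rewrite nth_mkseq //; case: i iL => [|i] iL /=; first exact: ve.
      by rewrite nth_mkseq 1?ltnW //; exact: ve.
    - move=> w; rewrite inE => /predU1P[->|]; first exact: VE.
      move=> /mapP[i]; rewrite mem_iota => /andP[_ iL] ->.
      by have [_ + _ _] := ve i iL; exact: VE.
  have lediv : ((A * L + size V * l) %/ l)%:R <= H * L%:R + (size V)%:R :> R.
    rewrite HE mulrAC -natrM -[X in _ + X](@mulfK _ l%:R) ?gt_eqF //.
    by rewrite -natrM -mulrDl -natrD ler_pdivlMr // -natrM ler_nat leq_trunc_div.
  apply: (@le_trans _ _ (n%:R + (H * L%:R + (size V)%:R))).
    apply: le_trans (_ : (n + (A * L + size V * l) %/ l)%:R <= _).
      by rewrite ler_nat.
    by rewrite natrD lerD2l.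
  have := mulr_ge0 H0 (ler0n R n); have := ler0n R A.
  by rewrite /C !natrD; lra.
have lower L : H * (L + n)%:R - C <= (trop_hilbert R a (L + n))%:R.
  have [v [ve vA]] := cycle_walk Tc.
  have le : ((L %/ l) * A <= trop_hilbert R a (L + n))%N.
    exact: leq_trans (vA L) (num_aug_le_hilbert L ve).
  (* The discarded incomplete turn costs at most A, since L is less than (L %/ l + 1) l. *)
  have : H * L%:R <= ((L %/ l) * A + A)%:R.
    rewrite HE mulrAC ler_pdivrMr // -!natrM ler_nat -mulSnr mulnAC mulnC leq_mul2r.
    by rewrite ltnW ?orbT // -ltn_divLR.
  move: le; rewrite -(ler_nat R) => le.
  have := ler0n R n; have := ler0n R (size V).
  by rewrite /C !natrD; lra.
have cvgH : trop_hilbert_ratio R a @ \oo --> H.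
  apply/cvgrPdist_le => e e0; near=> k.
  have k0 : (0 < k)%N by near: k; exact: nbhs_infty_gt.
  have nk : (n <= k)%N by near: k; exact: nbhs_infty_ge.
  (* This threshold makes the error C / k at most e. *)
  have Ck : C / e <= k%:R by near: k; exact: nbhs_infty_ger.
  have kR : (0 : R) < k%:R by rewrite ltr0n.
  have := upper (k - n)%N; have := lower (k - n)%N; rewrite subnK // => lo up.
  have Cke : C <= e * k%:R by rewrite mulrC -ler_pdivrMr.
  rewrite /trop_hilbert_ratio distrC ler_distl ler_pdivlMr // ler_pdivrMr //.
  by apply/andP; split; lra.
have limH : trop_entropy R a = H by exact: cvg_lim.
split.
- by apply/cvg_ex; exists H.
- by exists T.
- by move=> T' T'c; rewrite limH; exact: Tmax.
- exists (A%:R / l%:R); rewrite limH HE rmorphM /= fmorphV /=.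
  by rewrite !ratr_nat.
Unshelve. all: by end_near.
Qed.
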